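(* (a) Fix an integer $b\ge1$ and a real $\lambda>0$. There is a constant $C>0$, depending only on $b$ and $\lambda$, such that for every integer $t\ge1$ and every graph $G$ with $n\ge2$ vertices and treewidth at most $t$, the Glauber dynamics on the $b$-edge covers of $G$ with parameter $\lambda$ has mixing time $\tau(1/4)\le n^{Ct^2}$. (b) Fix a real $\lambda>0$. There is a constant $C>0$, depending only on $\lambda$, such that for every integer $t\ge1$ and every graph $G$ with $n\ge2$ vertices and treewidth at most $t$, the Glauber dynamics on the dominating sets of $G$ with parameter $\lambda$ has mixing time $\tau(1/4)\le n^{Ct}$. (c) Fix integers $b\ge1$, $\Delta\ge1$ and a real $\lambda>0$. There is a constant $C>0$, depending only on $b,\Delta,\lambda$, such that for every integer $t\ge 1$ and every graph $G$ with $n\ge 2$ vertices, maximum degree at most $\Delta$ and treewidth at most $t$, the Glauber dynamics on the $b$-matchings of $G$ with parameter $\lambda$ has mixing time $\tau(1/4)\le n^{Ct}$.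
   Context: A dominating set of $G=(V,E)$ is $S\subseteq V$ such that every vertex is in $S$ or adjacent to a vertex of $S$. A $b$-matching is a set $S\subseteq E$ such that every vertex has at most $b$ incident edges in $S$; a $b$-edge cover is a set $S\subseteq E$ such that every vertex has at least $b$ incident edges in $S$. Each Glauber dynamics with parameter $\lambda>0$ is the following chain on the corresponding valid sets (vertex sets for dominating sets, edge sets for $b$-matchings and $b$-edge covers): from the current valid set $X_t$, choose a ground element $x$ (a vertex, resp. an edge) uniformly at random; if toggling $x$ (adding it if absent, removing it if present) would produce an invalid set, set $X_{t+1}=X_t$; otherwise set $X_{t+1}=X_t\cup\{x\}$ with probability $\lambda/(\lambda+1)$ and $X_{t+1}=X_t\setminus\{x\}$ with probability $1/(\lambda+1)$. The stationary distribution is $\pi^*(S)\propto\lambda^{|S|}$. The mixing time $\tau(\varepsilon)$ is the minimum time $t$ such that from every starting state the total variation distance between the time-$t$ distribution and $\pi^*$ is less than $\varepsilon$. *)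

(* Defs.v *)
(* MathComp, with MathComp-Analysis for the reals. *)
From mathcomp Require Import all_boot all_order all_algebra.
From mathcomp Require Import boolp reals exp.

Set Implicit Arguments.
Unset Strict Implicit.
Unset Printing Implicit Defensive.

Import Order.TTheory GRing.Theory Num.Theory.

Record sgraph := SGraph {
  vertex :> finType;
  adj : rel vertex;
  adj_sym : symmetric adj;
  adj_irrefl : irreflexive adj }.

Definition edge_set (G : sgraph) : {set {set G}} :=
  [set a : {set G} | [exists x, exists y, adj x y && (a == [set x; y])]].

Definition max_degree (G : sgraph) : nat :=
  \max_(v : G) #|[set w | adj v w]|.

Definition is_tree (T : sgraph) : Prop :=
  [/\ 0 < #|T|,
      forall i j : T, connect (@adj T) i j &
      forall c : seq T, 2 < size c -> uniq c -> ~~ cycle (@adj T) c].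

Definition tree_decomposition (G T : sgraph) (B : T -> {set G}) : Prop :=
  [/\ is_tree T,
      forall v : G, exists i, v \in B i,
      forall v w : G, adj v w -> exists i, (v \in B i) && (w \in B i) &
      forall (v : G) (i j : T), v \in B i -> v \in B j ->
        connect [rel k l | [&& adj k l, v \in B k & v \in B l]] i j].

Definition decomposition_width (G T : sgraph) (B : T -> {set G}) : nat :=
  (\max_(i : T) #|B i|).-1.

Definition has_width_decomposition (G : sgraph) (w : nat) : Prop :=
  exists (T : sgraph) (B : T -> {set G}),
    tree_decomposition B /\ decomposition_width B = w.

Definition one_node : sgraph :=
  @SGraph unit (fun _ _ => false) (fun _ _ => erefl) (fun _ => erefl).

Lemma ex_decomposition (G : sgraph) :
  exists w, `[< has_width_decomposition G w >].
Proof.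
pose B : one_node -> {set G} := fun _ => [set: G].
exists (decomposition_width B); apply/asboolP; exists one_node, B; split=> //.
split.
- split; first by rewrite card_unit.
  + by case=> -[]; exact: connect0.
  + by case=> [|x [|y c]].
- by move=> v; exists tt; rewrite inE.
- by move=> v w _; exists tt; rewrite !inE.
- by move=> v [] [] _ _; exact: connect0.
Qed.

Definition treewidth (G : sgraph) : nat := ex_minn (ex_decomposition G).

Definition dominating_sets (G : sgraph) : {set {set G}} :=
  [set S : {set G} | [forall v, (v \in S) || [exists u in S, adj v u]]].

Definition incident (G : sgraph) (S : {set {set G}}) (v : G) : {set {set G}} :=
  [set a in S | v \in a].

Definition b_matchings (b : nat) (G : sgraph) : {set {set {set G}}} :=
  [set S : {set {set G}} |
    (S \subset edge_set G) && [forall v, #|incident S v| <= b]].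

Definition b_edge_covers (b : nat) (G : sgraph) : {set {set {set G}}} :=
  [set S : {set {set G}} |
    (S \subset edge_set G) && [forall v, b <= #|incident S v|]].

Local Open Scope ring_scope.

(* [D] is the set of ground elements and [F] the set of valid subsets of [D],
   which is the state space of the chain. *)
Section Glauber.
Variables (R : realType) (X : finType) (D : {set X}) (F : {set {set X}}).
Variable lambda : R.

Definition toggle (x : X) (S : {set X}) : {set X} :=
  if x \in S then S :\ x else x |: S.

Definition glauber_update (x : X) (S T : {set X}) : R :=
  if toggle x S \in F then
    lambda / (lambda + 1) * (T == x |: S)%:R
    + 1 / (lambda + 1) * (T == S :\ x)%:R
  else (T == S)%:R.

(* If there is no ground element to choose, the chain stays put. *)
Definition glauber_step (S T : {set X}) : R :=
  if D == set0 then (T == S)%:R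
  else #|D|%:R^-1 * \sum_(x in D) glauber_update x S T.

(* The law at time [s] of the chain started at [S]. *)
Fixpoint glauber_dist (s : nat) (S T : {set X}) : R :=
  if s is s'.+1 then \sum_(U in F) glauber_dist s' S U * glauber_step U T
  else (T == S)%:R.

Definition glauber_stationary (S : {set X}) : R :=
  lambda ^+ #|S| / \sum_(T in F) lambda ^+ #|T|.

(* Half the l1 distance, for distributions supported on the state space. *)
Definition tv_distance (mu nu : {set X} -> R) : R :=
  1 / 2 * \sum_(S in F) `|mu S - nu S|.

Definition mixed_at (eps : R) (s : nat) : Prop :=
  forall S, S \in F ->
    tv_distance (glauber_dist s S) glauber_stationary < eps.

Definition is_mixing_time (eps : R) (s : nat) : Prop :=
  mixed_at eps s /\ forall r, mixed_at eps r -> (s <= r)%N.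

End Glauber.

(* Main.v *)
(* The dynamics is compared with all pairs (I, J) of valid sets through paths
   that rewrite I into J along a linear order of the ground set.  Separators
   of a tree decomposition, applied recursively, give a vertex order each of
   whose prefixes has only O(t log n) vertices with a neighbour in the
   suffix.  Halfway, the set that equals J on a prefix and I on the rest can
   be invalid only near those vertices, and it is repaired there by a patch
   that does not depend on I and J (added vertices or edges, or for matchings
   deleted edges).  Hence (I, J) is recovered from the current set, the
   complementary splice and O(t log n) bits, so the congestion, the inverse
   Poincare constant and the mixing time are at most 2^O(t log n) = n^O(t). *)

(* One argument serves the three families because each is monotone: closed under adding ground
   elements, or under deleting them, the direction being a boolean [c]. Two valid sets that agree
   off a block [W] are joined by moving both in direction [c] until [W] is saturated, at a cost
   exponential in the size of [W] only. So consecutive patched splices may differ in a whole block,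
   and paths are never built as sequences of toggles: [f I - f J] is telescoped along the splices
   and squared. The obstacle is a patch that is small and yet blind to [(I, J)]. For covers, [b]
   fixed edges at a critical vertex suffice. For matchings the edges in excess depend on [(I, J)],
   so all edges at the vertex are deleted; this is where the degree bound enters. Sorting edges by
   their later endpoint leaves at most one critical vertex more than the vertex order has in its
   fronts. A start of exponentially small stationary weight costs only a factor linear in the ground
   set, since the chi-square distance decays geometrically. *)
Require Import Defs.
From mathcomp Require Import all_boot all_order all_algebra.
From mathcomp Require Import boolp reals exp.
From mathcomp Require Import zify ring lra.

Set Implicit Arguments.
Unset Strict Implicit.
Unset Printing Implicit Defensive.

Import Order.TTheory GRing.Theory Num.Theory.
Local Open Scope ring_scope.

(** * Branches of a tree at an oriented edge *)

Section TreeBranches.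
Variable T : sgraph.
Implicit Types i j k l : T.

Definition del_edge i j : rel T :=
  [rel k l | adj k l && ([set k; l] != [set i; j])].

Definition branch i j : {set T} := [set l | connect (del_edge i j) j l].

Lemma adj_neq (G : sgraph) (x y : G) : adj x y -> x != y.
Proof. by apply: contraTneq => ->; rewrite adj_irrefl. Qed.

Lemma del_edgeE i j k l :
  del_edge i j k l = adj k l && ([set k; l] != [set i; j]).
Proof. by []. Qed.

Lemma del_edgeC i j : del_edge i j =2 del_edge j i.
Proof. by move=> k l; rewrite !del_edgeE (setUC [set i]). Qed.

Lemma del_edge_sym i j : symmetric (del_edge i j).
Proof. by move=> k l; rewrite !del_edgeE adj_sym (setUC [set k]). Qed.

Lemma del_edge_connect_sym i j : connect_sym (del_edge i j).
Proof. exact/sym_connect_sym/del_edge_sym. Qed.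

Lemma branch_root i j : j \in branch i j.
Proof. by rewrite inE. Qed.

Lemma branch_closed i j k l :
  k \in branch i j -> del_edge i j k l -> l \in branch i j.
Proof.
by rewrite !inE => jk kl; apply: connect_trans jk (connect1 kl).
Qed.

(** A shortened path from [i] to [j] that avoids the edge has at least three vertices, so the edge
    closes it into a forbidden cycle. *)
Lemma tree_bridge i j : is_tree T -> adj i j -> i \notin branch i j.
Proof.
move=> [_ _ acyclicT] aij; rewrite inE del_edge_connect_sym.
apply/negP => /connectP[p]; case/shortenP => q pq uq _ lq.
have aq : path (@adj T) i q by apply: sub_path pq => x y /andP[].
case: q pq uq lq aq => [|x [|y q]] pq uq lq aq.
- by move: aij; rewrite lq adj_irrefl.
- by move: pq; rewrite lq /= del_edgeE eqxx andbF.
have /negP[] := acyclicT [:: i, x, y & q] isT uq.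
suff : path (@adj T) i (rcons [:: x, y & q] i) by [].
by rewrite rcons_path aq -lq adj_sym.
Qed.

Lemma branch_cover i l : is_tree T -> l != i -> exists2 j, adj i j & l \in branch i j.
Proof.
move=> [_ connT _] li.
pose a := [pred l | (l == i) || [exists j, adj i j && (l \in branch i j)]].
have clo : closed (@adj T) a.
  apply: intro_closed; first exact/sym_connect_sym/adj_sym.
  move=> x y axy; rewrite !inE => /orP[/eqP xi|/existsP[j /andP[aij xj]]].
    by apply/orP; right; apply/existsP; exists y; rewrite -{1}xi axy branch_root.
  have [e|ne] := eqVneq [set x; y] [set i; j].
    have : y \in [set i; j] by rewrite -e !inE eqxx orbT.
    rewrite !inE => /orP[->//|/eqP->]; apply/orP; right; apply/existsP; exists j.
    by rewrite aij branch_root.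
  apply/orP; right; apply/existsP; exists j; rewrite aij.
  by apply: branch_closed xj _; rewrite del_edgeE axy.
have := closed_connect clo (connT i l); rewrite !inE eqxx (negbTE li) /=.
by move=> /esym/existsP[j /andP[]]; exists j.
Qed.

(** This descent makes a minimal heavy branch useful. An edge other than [jk] that leaves
    [branch i j] could only be [ij], and neither of its ends lies in both branches; so the
    intersection is closed, and it contains [k]. *)
Lemma branch_proper i j k :
  is_tree T -> adj i j -> adj j k -> k != i -> branch j k \proper branch i j.
Proof.
move=> treeT aij ajk ki.
have nij : i != j by exact: adj_neq.
have kj : k != j by rewrite eq_sym; exact: adj_neq.
have jNjk : j \notin branch j k by exact: tree_bridge.
have iNij : i \notin branch i j by exact: tree_bridge.
apply/properP; split; last by exists j => //; exact: branch_root.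
have clo : closed (del_edge j k) (mem (branch i j :&: branch j k)).
  apply: intro_closed; first exact: del_edge_connect_sym.
  move=> x y exy /setIP[xA xB]; rewrite inE (branch_closed xB exy) andbT.
  apply: branch_closed (xA) _; case/andP: exy => axy _; rewrite del_edgeE axy /=.
  apply/eqP => e; have : x \in [set i; j] by rewrite -e !inE eqxx.
  by rewrite !inE => /orP[] /eqP xE; move: xA xB; rewrite xE ?(negbTE iNij) ?(negbTE jNjk).
have kA : k \in branch i j.
  apply: branch_closed (branch_root i j) _; rewrite del_edgeE ajk /=.
  apply: contraNneq ki => e; have : k \in [set i; j] by rewrite -e !inE eqxx orbT.
  by rewrite !inE (negbTE kj) orbF.
apply/subsetP => l lB; have kl : connect (del_edge j k) k l by rewrite inE in lB.
have := closed_connect clo kl.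
by rewrite /= !in_setI kA branch_root => /esym/andP[].
Qed.

End TreeBranches.

(** * Balanced separators from a tree decomposition *)

Section Separators.
Variables (G T : sgraph) (B : T -> {set G}).
Hypothesis decB : tree_decomposition B.

Definition bags_in (A : {set T}) (v : G) := [forall k, (v \in B k) ==> (k \in A)].

Definition branch_part (U : {set G}) (i j : T) : {set G} :=
  [set v in U | (v \notin B i) && bags_in (branch i j) v].

(** The nodes whose bags contain [v] are connected and avoid [i], so they cannot cross the edge
    [ij]. *)
Lemma bags_in_branch i j k v :
  v \notin B i -> v \in B k -> k \in branch i j -> bags_in (branch i j) v.
Proof.
case: decB => _ _ _ conB vi vk; rewrite inE => kj.
apply/forallP => l; apply/implyP => vl; rewrite inE.
apply: (connect_trans kj); apply: connect_sub (conB v k l vk vl) => x y /= /and3P[axy vx vy].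
apply: connect1; rewrite del_edgeE axy /=; apply/eqP => e.
have : i \in [set x; y] by rewrite e !inE eqxx.
by rewrite !inE => /orP[]/eqP iE; move: vi; rewrite iE ?vx ?vy.
Qed.

Lemma branch_part_cover (U : {set G}) i v :
  v \in U -> v \notin B i -> exists2 j, adj i j & v \in branch_part U i j.
Proof.
case: (decB) => treeT covB _ _ vU vi; have [k vk] := covB v.
have ki : k != i by apply: contraNneq vi => <-.
have [j aij kj] := branch_cover treeT ki; exists j => //.
by rewrite inE vU vi; apply: bags_in_branch kj.
Qed.

Lemma branch_part_adj (U : {set G}) i j v w :
  v \in branch_part U i j -> adj v w -> w \in U -> w \notin B i ->
  w \in branch_part U i j.
Proof.
case: (decB) => _ _ adjB _; rewrite !inE => /and3P[_ vi vj] avw -> wi.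
have [k /andP[vk wk]] := adjB v w avw; rewrite wi.
by apply: bags_in_branch wk _ => //; move/forallP/(_ k)/implyP: vj; apply.
Qed.

(** Among the oriented edges whose part holds more than half of [U], one with the smallest branch
    points to a balanced node: a heavy edge leading further would have a smaller branch, and a heavy
    edge leading back would give two disjoint parts, each above half. *)
Lemma balanced_separator U :
  exists i, forall j, adj i j -> (2 * #|branch_part U i j| <= #|U|)%N.
Proof.
case: (decB) => treeT covB _ _; case: (treeT) => /card_gt0P[i0 _] _ _.
pose heavy (e : T * T) := adj e.1 e.2 && (#|U| < 2 * #|branch_part U e.1 e.2|)%N.
have [e0 he0|noheavy] := pickP heavy; last first.
  by exists i0 => j aij; rewrite leqNgt; move: (noheavy (i0, j)); rewrite /heavy /= aij /= => ->.
case: (arg_minnP (fun e : T * T => #|branch e.1 e.2|) he0) => -[i j].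
rewrite {1}/heavy /= => /andP[aij hij] mine.
exists j => k ajk; rewrite leqNgt; apply/negP => hjk.
have [ki|ki] := eqVneq k i; last first.
  have := mine (j, k); rewrite /heavy /= ajk hjk => /(_ isT).
  by rewrite leqNgt proper_card// branch_proper.
rewrite {k}ki in ajk hjk.
have dis : branch_part U i j :&: branch_part U j i = set0.
  apply/setP => v; rewrite in_set0; apply/negP => /setIP[].
  rewrite !inE => /and3P[_ _ /forallP vij] /and3P[_ _ /forallP vji].
  have [k vk] := covB v.
  move: (vij k) (vji k); rewrite vk /= !inE => jk ik.
  have := tree_bridge treeT aij; rewrite inE => /negP[].
  apply: connect_trans jk _; rewrite del_edge_connect_sym.
  by rewrite (eq_connect (del_edgeC i j)).
have : (#|branch_part U i j| + #|branch_part U j i| <= #|U|)%N.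
  rewrite -cardsUI dis cards0 addn0; apply: subset_leq_card.
  by apply/subsetP => v; rewrite !inE => /orP[]/andP[].
by move: hij hjk; lia.
Qed.

End Separators.

(** * Vertex orders with small fronts *)

Section LinearOrders.
Variable G : sgraph.

Definition cut_front (s : seq G) (k : nat) : {set G} :=
  [set x in take k s | [exists y in drop k s, adj x y]].

(** This says that the subgraph induced on [U] has vertex separation number at most [w], a layout
    parameter equal to pathwidth. *)
Definition has_order (U : {set G}) (w : nat) : Prop :=
  exists s : seq G, [/\ uniq s, s =i U & forall k, (#|cut_front s k| <= w)%N].

Lemma has_order0 w : has_order set0 w.
Proof.
exists [::]; split=> // [x|k]; first by rewrite inE.
by rewrite (_ : cut_front _ _ = set0) ?cards0//; apply/setP => x; rewrite !inE.
Qed.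

(** No edge joins the two pieces, so every front of the concatenated order lies in one piece: widths
    combine by maximum, not by sum. *)
Lemma has_order_disconnected (U U1 : {set G}) w :
  (forall x y, x \in U :&: U1 -> y \in U :\: U1 -> ~~ adj x y) ->
  has_order (U :&: U1) w -> has_order (U :\: U1) w -> has_order U w.
Proof.
move=> noadj [s1 [us1 ms1 ws1]] [s2 [us2 ms2 ws2]]; exists (s1 ++ s2); split.
- rewrite cat_uniq us1 us2 andbT /=; apply/hasPn => x.
  by rewrite ms2 ms1 !inE => /andP[/negbTE->]; rewrite andbF.
- by move=> x; rewrite mem_cat ms1 ms2 !inE; case: (x \in U1); rewrite /= ?andbT ?andbF ?orbF.
- move=> k; have [lt_k|le_k] := ltnP k (size s1).
    apply: leq_trans (ws1 k); apply: subset_leq_card; apply/subsetP => x.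
    rewrite !inE take_cat drop_cat lt_k => /andP[xs /existsP[y /andP[ys axy]]].
    rewrite xs; apply/existsP; exists y; rewrite axy andbT.
    move: ys; rewrite mem_cat => /orP[//|]; rewrite ms2 => ys.
    by have := noadj x y; rewrite -ms1 (mem_take xs) ys axy => /(_ isT isT).
  apply: leq_trans (ws2 (k - size s1)%N); apply: subset_leq_card; apply/subsetP => x.
  rewrite !inE take_cat drop_cat ltnNge le_k /= mem_cat => /andP[xs /existsP[y /andP[ys axy]]].
  apply/andP; split; last by apply/existsP; exists y; rewrite ys.
  case/orP: xs => // xs; have := noadj x y.
  by rewrite -ms1 xs -ms2 (mem_drop ys) axy => /(_ isT isT).
Qed.

(** Listing the separator before everything else adds at most its size to every front. *)
Lemma has_order_setD (U S : {set G}) w1 w2 :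
  (#|S| <= w1)%N -> has_order (U :\: S) w2 -> has_order U (w1 + w2)%N.
Proof.
move=> cS [s [us ms ws]]; exists (enum (U :&: S) ++ s); split.
- rewrite cat_uniq us enum_uniq andbT /=; apply/hasPn => x.
  by rewrite ms mem_enum !inE => /andP[/negbTE->]; rewrite andbF.
- by move=> x; rewrite mem_cat ms mem_enum !inE; case: (x \in S); rewrite /= ?andbT ?andbF ?orbF.
move=> k; pose k' := (k - size (enum (U :&: S)))%N.
apply: (@leq_trans #|S :|: cut_front s k'|); last first.
  by rewrite (leq_trans (leq_card_setU _ _))// leq_add.
apply: subset_leq_card; apply/subsetP => x; rewrite !inE take_cat drop_cat -/k'.
case: ifP => _ /andP[xs /existsP[y /andP[ys axy]]].
  by move: (mem_take xs); rewrite mem_enum inE => /andP[_ ->].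
move: xs; rewrite mem_cat mem_enum inE => /orP[/andP[_ ->]//|->] /=.
by apply/orP; right; apply/existsP; exists y; rewrite ys.
Qed.

(** Each level of the recursion pays for one bag and halves the set, so [k] counts levels. *)
Lemma decomposition_order (T : sgraph) (B : T -> {set G}) (t k : nat) (U : {set G}) :
  tree_decomposition B -> (forall i, #|B i| <= t)%N -> (#|U| < 2 ^ k)%N ->
  has_order U (k * t)%N.
Proof.
move=> decB cB; elim: k U => [|k IH] U.
  by rewrite expn0 ltnS leqn0 cards_eq0 => /eqP->; exact: has_order0.
move=> cU; have [i iP] := balanced_separator decB U.
rewrite mulSn; apply: (has_order_setD (cB i)).
(* The parts left by the bag are peeled off one at a time; being mutually nonadjacent, they all
   share the width [k * t]. *)
suff pieces : forall n (U' : {set G}),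
    (#|U'| <= n)%N -> U' \subset U :\: B i -> has_order U' (k * t)%N.
  by apply: (pieces _ _ (leqnn _)).
elim=> [|n IHn] U'.
  by rewrite leqn0 cards_eq0 => /eqP-> _; exact: has_order0.
move=> cU' sU'; have [->|[v vU']] := set_0Vmem U'; first exact: has_order0.
have [vi vU] : v \notin B i /\ v \in U by move/subsetP/(_ v vU'): sU'; rewrite inE => /andP[].
have [j aij vj] := branch_part_cover decB vU vi.
apply: (@has_order_disconnected _ (branch_part B U i j)).
- move=> x y; rewrite in_setI in_setD => /andP[xU' xj] /andP[yj yU'].
  apply: contraNN yj => axy; apply: branch_part_adj xj axy _ _ => //.
  + by move/subsetP/(_ y yU'): sU' => /setDP[].
  + by move/subsetP/(_ y yU'): sU' => /setDP[].
- apply: IH; have := subset_leq_card (subsetIr U' (branch_part B U i j)).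
  by have := iP j aij; rewrite expnS in cU; move: cU; lia.
apply: IHn; last by apply: subset_trans sU'; exact: subsetDl.
rewrite -ltnS; apply: leq_trans cU'; apply: proper_card.
apply/properP; split; first exact: subsetDl.
by exists v => //; rewrite in_setD vj.
Qed.

Lemma treewidth_order (t : nat) :
  (treewidth G <= t)%N -> has_order [set: G] ((trunc_log 2 #|G|).+1 * t.+1)%N.
Proof.
rewrite /treewidth; case: ex_minnP => w /asboolP[T [B [decB wB]]] _ wt.
apply: (@decomposition_order T B); first exact: decB.
(* A bag may have one vertex more than the width, hence [t.+1] in the bound. *)
- move=> i; apply: leq_trans (_ : (w.+1 <= _)%N) => //; rewrite -wB.
  by apply: leq_trans (leqSpred _); exact: leq_bigmax.
- by rewrite cardsT; exact: trunc_log_ltn.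
Qed.

End LinearOrders.

(** * Inequalities for finite sums *)

Section Sums.
Variable R : realFieldType.

Lemma ler_sum_subpred (I : finType) (P Q : pred I) (E : I -> R) :
  (forall i, P i -> Q i) -> (forall i, Q i -> 0 <= E i) ->
  \sum_(i | P i) E i <= \sum_(i | Q i) E i.
Proof.
move=> PQ E0; rewrite big_mkcond [leRHS]big_mkcond; apply: ler_sum => i _.
by case: ifPn => [/PQ->//|_]; case: ifPn => [/E0|].
Qed.

Lemma ler_sum_term (I : finType) (P : pred I) (E : I -> R) i :
  P i -> (forall j, P j -> 0 <= E j) -> E i <= \sum_(j | P j) E j.
Proof.
move=> Pi E0; rewrite (bigD1 i)//= lerDl; apply: sumr_ge0 => j /andP[Pj _].
exact: E0.
Qed.

(** The unnormalised variance identity; it yields Cauchy-Schwarz here and the chi-square distance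
    later. *)
Lemma sum_sqr_diff (I : finType) (P : pred I) (w f : I -> R) :
  \sum_(i | P i) \sum_(j | P j) w i * w j * (f i - f j) ^+ 2 =
  2 * ((\sum_(i | P i) w i) * \sum_(i | P i) w i * f i ^+ 2)
  - 2 * (\sum_(i | P i) w i * f i) ^+ 2.
Proof.
have e1 : (\sum_(i | P i) w i * f i) ^+ 2 =
    \sum_(i | P i) \sum_(j | P j) w i * w j * (f i * f j).
  rewrite expr2 mulr_suml; apply: eq_bigr => i _.
  by rewrite mulr_sumr; apply: eq_bigr => j _; ring.
have e2 : (\sum_(i | P i) w i) * (\sum_(i | P i) w i * f i ^+ 2) =
    \sum_(i | P i) \sum_(j | P j) w i * w j * f j ^+ 2.
  rewrite mulr_suml; apply: eq_bigr => i _.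
  by rewrite mulr_sumr; apply: eq_bigr => j _; ring.
have e3 : (\sum_(i | P i) w i) * (\sum_(i | P i) w i * f i ^+ 2) =
    \sum_(i | P i) \sum_(j | P j) w i * w j * f i ^+ 2.
  rewrite e2 exchange_big /=; apply: eq_bigr => i _.
  by apply: eq_bigr => j _; ring.
rewrite e1 (_ : 2 * _ = \sum_(i | P i) \sum_(j | P j) w i * w j * f j ^+ 2 +
  \sum_(i | P i) \sum_(j | P j) w i * w j * f i ^+ 2); last by rewrite -e2 -e3; ring.
rewrite -big_split mulr_sumr -sumrB; apply: eq_bigr => i _ /=.
rewrite -big_split mulr_sumr -sumrB; apply: eq_bigr => j _ /=; ring.
Qed.

Lemma weighted_sqr_sum_le (I : finType) (P : pred I) (w f : I -> R) :
  (forall i, 0 <= w i) ->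
  (\sum_(i | P i) w i * f i) ^+ 2 <=
  (\sum_(i | P i) w i) * \sum_(i | P i) w i * f i ^+ 2.
Proof.
move=> w0; have := sum_sqr_diff P w f.
have : 0 <= \sum_(i | P i) \sum_(j | P j) w i * w j * (f i - f j) ^+ 2.
  apply: sumr_ge0 => i _; apply: sumr_ge0 => j _.
  by apply: mulr_ge0; [apply: mulr_ge0|apply: sqr_ge0].
by move=> h0 h; move: h0; rewrite h; lra.
Qed.

Lemma sqr_sum_le (I : finType) (A : {pred I}) (f : I -> R) :
  (\sum_(i in A) f i) ^+ 2 <= #|A|%:R * \sum_(i in A) f i ^+ 2.
Proof.
have := @weighted_sqr_sum_le I (mem A) (fun _ => 1) f (fun _ => ler01).
rewrite sumr_const; under eq_bigr do rewrite mul1r.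
by under [X in _ <= _ * X -> _]eq_bigr do rewrite mul1r.
Qed.

Lemma sqr_telescope_le (a : nat -> R) m :
  (a 0%N - a m) ^+ 2 <= m%:R * \sum_(k < m) (a k - a k.+1) ^+ 2.
Proof.
have -> : a 0%N - a m = \sum_(k < m) (a k - a k.+1).
  elim: m => [|m IH]; first by rewrite big_ord0 subrr.
  by rewrite big_ord_recr /= -IH addrA subrK.
have := sqr_sum_le 'I_m (fun k : 'I_m => a k - a k.+1).
by rewrite card_ord.
Qed.

End Sums.

(** * Monotone moves and splices *)

Section SetMoves.
Variable X : finType.
Implicit Types (S T W E L I J : {set X}) (c : bool).

(** The boolean [c] is the monotone direction: insertion for dominating sets and edge covers,
    deletion for matchings. *)
Definition put c x S := if c then x |: S else S :\ x.

Definition fill c S W := if c then S :|: W else S :\: W.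

Definition splice L I J := (J :&: L) :|: (I :\: L).

Lemma put_toggle c x S : put c x S != S -> put c x S = toggle x S.
Proof.
rewrite /put /toggle; case: c; case: ifP => //.
  by move=> xS; rewrite (setUidPr _) ?sub1set// eqxx.
by move=> /negbT xS; rewrite (setDidPl _) ?eqxx// disjoint_sym disjoints1.
Qed.

Lemma toggleK (x : X) : involutive (toggle x).
Proof.
move=> S; rewrite {2}/toggle; case: ifP => xS; rewrite /toggle !inE eqxx /=.
  by rewrite setD1K.
by rewrite setU1K ?xS.
Qed.

Lemma fill_set0 c S : fill c S set0 = S.
Proof. by case: c; rewrite /fill ?setU0 ?setD0. Qed.

Lemma fill_put c S W x :
  x \in W -> fill c (put c x S) (W :\ x) = fill c S W.
Proof.
move=> xW; apply/setP => y; rewrite /fill /put; case: c; rewrite !inE.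
  by case: eqVneq => [->|]; rewrite ?xW ?orbT.
by case: eqVneq => [->|]; rewrite ?xW //= andbT.
Qed.

Lemma fill_setD c S W E : E \subset W -> fill c S E :\: W = S :\: W.
Proof.
move=> /subsetP EW; apply/setP => y; rewrite /fill; case: c; rewrite !inE;
  have := EW y; case: (y \in E) => [->|]//; by rewrite ?orbF ?andbF.
Qed.

Lemma eq_fill c S T W : S :\: W = T :\: W -> fill c S W = fill c T W.
Proof.
move=> ST; rewrite /fill; case: c => //; apply/setP => y.
have := congr1 (fun A : {set X} => y \in A) ST.
by rewrite !inE; case: (y \in W); rewrite ?orbT ?orbF.
Qed.

(** The pair of splices determines [(I, J)]: the encoding is injective. *)
Lemma splice_invol L I J : splice L (splice L I J) (splice L J I) = I.
Proof.
by apply/setP => y; rewrite !inE; case: (y \in L); rewrite /= ?andbT ?andbF ?orbF ?orFb.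
Qed.

(** By this the encoding preserves the product of the two weights. *)
Lemma card_splice L I J : (#|splice L I J| + #|splice L J I| = #|I| + #|J|)%N.
Proof.
have h (A B : {set X}) : #|splice L A B| = (#|B :&: L| + #|A :\: L|)%N.
  rewrite cardsU (_ : (B :&: L) :&: (A :\: L) = set0) ?cards0 ?subn0//.
  by apply/setP => y; rewrite !inE; case: (y \in L); rewrite ?andbF.
by rewrite !h -(cardsID L I) -(cardsID L J); lia.
Qed.

End SetMoves.

(** * Poincare inequality for a monotone family *)

Section Poincare.
Variables (R : realType) (X : finType) (D : {set X}) (F : {set {set X}}).
Variables (lambda : R) (c : bool).
Hypothesis lambda_gt0 : 0 < lambda.
Hypothesis subD : forall S, S \in F -> S \subset D.
Hypothesis put_closed : forall S x, S \in F -> x \in D -> put c x S \in F.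
Implicit Types (S T W L A B : {set X}) (f : {set X} -> R).

Definition weight S : R := lambda ^+ #|S|.

Definition weight_total : R := \sum_(S in F) weight S.

Definition local_energy f B : R :=
  \sum_(x in D | toggle x B \in F) (f B - f (toggle x B)) ^+ 2.

Lemma lambda_ge0 : 0 <= lambda. Proof. exact: ltW. Qed.

Lemma weight_gt0 S : 0 < weight S. Proof. exact: exprn_gt0. Qed.

Lemma weight_ge0 S : 0 <= weight S. Proof. exact/ltW/weight_gt0. Qed.

Lemma weight_total_ge0 : 0 <= weight_total.
Proof. by apply: sumr_ge0 => S _; exact: weight_ge0. Qed.

Lemma local_energy_ge0 f B : 0 <= local_energy f B.
Proof. by apply: sumr_ge0 => x _; exact: sqr_ge0. Qed.

Lemma sqr_put_le f S x :
  S \in F -> x \in D -> (f S - f (put c x S)) ^+ 2 <= local_energy f S.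
Proof.
move=> SF xD; have [->|ne] := eqVneq (put c x S) S.
  by rewrite subrr expr0n local_energy_ge0.
have tF := put_closed SF xD; rewrite (put_toggle ne) in tF *.
apply: (@ler_sum_term _ _ _ (fun x => (f S - f (toggle x S)) ^+ 2)).
  by rewrite xD tF.
by move=> y _; exact: sqr_ge0.
Qed.

Lemma sqr_fill_le f W S : W \subset D -> S \in F ->
  (f S - f (fill c S W)) ^+ 2 <=
  4 ^+ #|W| * \sum_(B in F | B :\: W == S :\: W) local_energy f B.
Proof.
elim: {W}#|W| {-2}W (erefl #|W|) S => [|n IH] W.
  move=> /cards0_eq -> S _ _; rewrite fill_set0 subrr expr0n cards0 expr0 mul1r /=.
  by apply: sumr_ge0 => B _; exact: local_energy_ge0.
move=> cW S WD SF; have [x xW] : exists x, x \in W by apply/card_gt0P; rewrite cW.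
have xD : x \in D by exact: (subsetP WD).
set q := \sum_(_ in _ | _) _.
pose S1 := put c x S.
have S1F : S1 \in F by exact: put_closed.
have cW1 : #|W :\ x| = n by move: cW; rewrite (cardsD1 x) xW => -[].
have W1D : W :\ x \subset D by apply: subset_trans WD; exact: subsetDl.
have := IH _ cW1 S1 W1D S1F; rewrite fill_put// cW1 => h2.
have h1 := sqr_put_le f SF xD; rewrite -/S1 in h1.
have e1 : S1 :\: W = S :\: W.
  by apply/setP => y; rewrite /S1 /put; case: c; rewrite !inE; case: eqVneq => // ->; rewrite xW.
have le1 : local_energy f S <= q.
  apply: (@ler_sum_term _ _ _ (local_energy f)); first by rewrite SF /=.
  by move=> B _; exact: local_energy_ge0.
have le2 : \sum_(B in F | B :\: (W :\ x) == S1 :\: (W :\ x)) local_energy f B <= q.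
  apply: ler_sum_subpred => [B|B _]; last exact: local_energy_ge0.
  case/andP => -> /eqP e /=; rewrite -e1.
  have : W :\ x \subset W by exact: subsetDl.
  move=> /setUidPr eW; rewrite -eW -!setDDl e; exact: eqxx.
have q0 : 0 <= q by apply: sumr_ge0 => B _; exact: local_energy_ge0.
have p4 : 1 <= 4 ^+ n :> R by rewrite exprn_ege1// ler1n.
have h3 : (f S1 - f (fill c S W)) ^+ 2 <= 4 ^+ n * q.
  by apply: (le_trans h2); rewrite ler_wpM2l// (le_trans ler01).
have h4 : q <= 4 ^+ n * q by rewrite ler_peMl.
rewrite cW (exprS 4) -mulrA; set z := 4 ^+ n * q in h3 h4 *.
(* A squared second difference: it gives [(u + v)^2 <= 2 u^2 + 2 v^2] for the two increments, both
   of whose squares are at most [z]. *)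
have := sqr_ge0 (f S - 2 * f S1 + f (fill c S W)).
nra.
Qed.

(* Any two valid sets that agree off [W] are joined by toggles inside [W]
   through their common saturation [fill c S W]. *)
Lemma sqr_block_le f W S T :
  W \subset D -> S \in F -> T \in F -> S :\: W = T :\: W ->
  (f S - f T) ^+ 2 <=
  4 ^+ #|W|.+1 * \sum_(B in F | B :\: W == S :\: W) local_energy f B.
Proof.
move=> WD SF TF eST; have hS := sqr_fill_le f WD SF; have hT := sqr_fill_le f WD TF.
rewrite -(eq_fill c eST) -eST in hT; rewrite (exprS 4) -mulrA.
set z := 4 ^+ _ * _ in hS hT *.
have := sqr_ge0 (f S + f T - 2 * f (fill c S W)).
nra.
Qed.

(** Dominates 1, [lambda] and [lambda^-1] at once, so small and large parameters need no separate
    treatment. *)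
Definition weight_ratio : R := 1 + lambda + lambda^-1.

Lemma weight_ratio_ge1 : 1 <= weight_ratio.
Proof. by rewrite /weight_ratio -addrA lerDl addr_ge0 ?invr_ge0 ?lambda_ge0. Qed.

Lemma weight_block_le W A B : A :\: W = B :\: W ->
  weight A <= weight_ratio ^+ (2 * #|W|) * weight B.
Proof.
move=> eAB; rewrite /weight -(cardsID W A) -(cardsID W B) eAB mul2n -addnn !exprD mulrA.
rewrite ler_wpM2r ?exprn_ge0 ?lambda_ge0// -mulrA.
have r1 := weight_ratio_ge1; have r0 : 0 <= weight_ratio by rewrite (le_trans ler01).
have lr : lambda <= weight_ratio.
  by rewrite /weight_ratio addrAC lerDr addr_ge0 ?invr_ge0 ?lambda_ge0.
have ir : lambda^-1 <= weight_ratio by rewrite /weight_ratio lerDr addr_ge0 ?lambda_ge0.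
have le_pow n : (n <= #|W|)%N -> weight_ratio ^+ n <= weight_ratio ^+ #|W|.
  by move=> ?; rewrite ler_weXn2l.
have h1 : lambda ^+ #|A :&: W| <= weight_ratio ^+ #|W|.
  apply: le_trans (le_pow _ (subset_leq_card (subsetIr A W))).
  by rewrite lerXn2r ?nnegrE ?lambda_ge0.
have h2 : 1 <= weight_ratio ^+ #|W| * lambda ^+ #|B :&: W|.
  have <- : lambda^-1 ^+ #|B :&: W| * lambda ^+ #|B :&: W| = 1.
    by rewrite -exprMn mulVf ?gt_eqF// expr1n.
  rewrite ler_wpM2r ?exprn_ge0 ?lambda_ge0//.
  apply: le_trans (le_pow _ (subset_leq_card (subsetIr B W))).
  by rewrite lerXn2r ?nnegrE ?invr_ge0 ?lambda_ge0.
by apply: (le_trans h1); rewrite ler_peMr ?exprn_ge0.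
Qed.

(** Per element of a block: 2 for its membership, [weight_ratio ^+ 2] for the change of weight. *)
Definition block_const : R := 2 * weight_ratio ^+ 2.

Lemma block_const_ge1 : 1 <= block_const.
Proof.
by rewrite /block_const mulr_ege1 ?ler1n// exprn_ege1// weight_ratio_ge1.
Qed.

Lemma card_block W B : (#|[set A : {set X} | A :\: W == B :\: W]| <= 2 ^ #|W|)%N.
Proof.
rewrite -card_powerset.
have inj : {in [set A : {set X} | A :\: W == B :\: W] &, injective (fun A => A :&: W)}.
  move=> A1 A2; rewrite !inE => /eqP e1 /eqP e2 e.
  by rewrite -(setID A1 W) -(setID A2 W) e e1 e2.
rewrite -(card_in_imset inj); apply: subset_leq_card; apply/subsetP => S /imsetP[A _ ->].
by rewrite inE subsetIr.
Qed.

Lemma sum_block_le W B :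
  \sum_(A : {set X} | A :\: W == B :\: W) weight A <= block_const ^+ #|W| * weight B.
Proof.
apply: (@le_trans _ _ (\sum_(A : {set X} | A :\: W == B :\: W)
    (weight_ratio ^+ (2 * #|W|) * weight B))).
  by apply: ler_sum => A /eqP; exact: weight_block_le.
rewrite sumr_const -mulr_natl /block_const exprMn -exprM mulrA.
rewrite ler_wpM2r ?weight_ge0// ler_wpM2r ?exprn_ge0 ?(le_trans ler01 weight_ratio_ge1)//.
rewrite -natrX ler_nat; apply: leq_trans (card_block W B).
by apply: subset_leq_card; apply/subsetP => A; rewrite !inE.
Qed.

(* The encoding: [(I, J)] is recovered from [splice L I J] and
   [splice L J I], and the latter is valid off [W]. *)
Lemma sum_splice_le L W B :
  (forall I J, I \in F -> J \in F ->
     exists2 M, M \in F & M :\: W = splice L I J :\: W) ->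
  \sum_(I in F) \sum_(J in F | splice L I J :\: W == B :\: W) weight I * weight J <=
  block_const ^+ (2 * #|W|) * weight_total * weight B.
Proof.
move=> validL.
pose Q (Z : {set X}) := [exists M in F, Z :\: W == M :\: W].
pose h (p : {set X} * {set X}) := (splice L p.1 p.2, splice L p.2 p.1).
have hK : involutive h by move=> [I J]; rewrite /h /= !splice_invol.
rewrite pair_big_dep /=.
apply: (@le_trans _ _ (\sum_(p : {set X} * {set X} | (p.1 :\: W == B :\: W) && Q p.2)
   weight p.1 * weight p.2)).
  (* After passing to the pair of splices, the first set ranges over the block of [B], and the
     second agrees off [W] with some valid set. *)
  rewrite (reindex_inj (inv_inj hK)) /=.
  rewrite (eq_bigr (fun p => weight p.1 * weight p.2)); last first.
    by move=> [I J] _ /=; rewrite /weight -!exprD card_splice.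
  apply: ler_sum_subpred => [[I J]|[I J] _] /=; last by rewrite mulr_ge0 ?weight_ge0.
  rewrite splice_invol => /and3P[IF JF ->] /=.
  have [M MF eM] := validL _ _ JF IF; apply/existsP; exists M.
  by rewrite MF eM splice_invol /=.
rewrite -(pair_big (fun A => A :\: W == B :\: W) Q (fun A B => weight A * weight B)) /=.
rewrite (eq_bigr (fun A => weight A * \sum_(Z | Q Z) weight Z)); last first.
  by move=> A _; rewrite mulr_sumr.
rewrite -mulr_suml mul2n -addnn exprD.
have hQ : \sum_(Z | Q Z) weight Z <= block_const ^+ #|W| * weight_total.
  apply: (@le_trans _ _ (\sum_(M in F) \sum_(Z : {set X} | Z :\: W == M :\: W) weight Z)).
    rewrite (exchange_big_dep predT) //= [leRHS](bigID Q) /= -[leLHS]addr0.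
    apply: lerD; last by apply: sumr_ge0 => Z _; apply: sumr_ge0 => M _; exact: weight_ge0.
    apply: ler_sum => Z /existsP[M /andP[MF eM]].
    apply: (@ler_sum_term _ _ _ (fun _ => weight Z) M); first by rewrite MF.
    by move=> *; exact: weight_ge0.
  by rewrite mulr_sumr; apply: ler_sum => M _; exact: sum_block_le.
have -> : block_const ^+ #|W| * block_const ^+ #|W| * weight_total * weight B =
  (block_const ^+ #|W| * weight B) * (block_const ^+ #|W| * weight_total) by ring.
apply: ler_pM => //; last exact: sum_block_le.
  by apply: sumr_ge0 => *; exact: weight_ge0.
by apply: sumr_ge0 => *; exact: weight_ge0.
Qed.

Variables (s : seq X) (E : nat -> {set X}) (w : nat).
Hypothesis mem_s : s =i D.
Hypothesis subE : forall k, E k \subset D.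
Hypothesis card_E : forall k, (#|E k| <= w)%N.
Hypothesis valid_E : forall k I J, I \in F -> J \in F ->
  fill c (splice [set x in take k s] I J) (E k) \in F.

(** A step of the path changes at most [2 * w + 1] elements. Rerouting it costs 4 per element and
    one factor 4 more; the encoding costs [block_const ^+ 2] per element. *)
Definition poincare_const : R := (4 * block_const ^+ 2) ^+ (2 * w).+2.

Let m := size s.
Let L k : {set X} := [set x in take k s].
(** The patch is emptied at both ends, so that the path starts exactly at [I] and stops exactly at
    [J]. *)
Let E' k := if (k == 0)%N || (k == m) then set0 else E k.
Let M k I J := fill c (splice (L k) I J) (E' k).
(** Both patches and the element by which the prefix grows: off this set [M k] and [M k.+1] agree
    with the splice at [k]. *)
Let W k := E' k :|: E' k.+1 :|: (L k.+1 :\: L k).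

Let L_sub k : L k \subset D.
Proof. by apply/subsetP => x; rewrite inE => /mem_take; rewrite mem_s. Qed.

Let M0 I J : M 0 I J = I.
Proof.
rewrite /M /E' /= fill_set0 /splice (_ : L 0 = set0) ?setI0 ?set0U ?setD0//.
by apply/setP => x; rewrite !inE take0.
Qed.

Let Mm I J : I \in F -> J \in F -> M m I J = J.
Proof.
move=> /subD ID /subD JD; rewrite /M /E' eqxx orbT fill_set0 /splice.
have -> : L m = D by apply/setP => x; rewrite inE /m take_size mem_s.
by rewrite (setIidPl JD) (_ : I :\: D = set0) ?setU0//; apply/eqP; rewrite setD_eq0.
Qed.

Let M_valid k I J : I \in F -> J \in F -> M k I J \in F.
Proof.
move=> IF JF; have [->|k0] := eqVneq k 0%N; first by rewrite M0.
have [->|km] := eqVneq k m; first by rewrite Mm.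
by rewrite /M /E' (negbTE k0) (negbTE km); exact: valid_E.
Qed.

Let W_sub k : W k \subset D.
Proof.
have E'D j : E' j \subset D by rewrite /E'; case: ifP => // _; exact: sub0set.
rewrite /W !subUset !E'D /=; apply: subset_trans (L_sub k.+1); exact: subsetDl.
Qed.

Let W_card k : (#|W k| <= (2 * w).+1)%N.
Proof.
have E'w j : (#|E' j| <= w)%N by rewrite /E'; case: ifP => // _; rewrite cards0.
have L1 : (#|L k.+1 :\: L k| <= 1)%N.
  have [km|km] := ltnP k (size s); last first.
    rewrite (_ : _ :\: _ = set0) ?cards0//; apply/setP => x.
    by rewrite !inE !take_oversize ?andNb// (leq_trans km).
  have [x0 _] : exists x0 : X, true by case: (s) km => // x0 *; exists x0.
  apply: (@leq_trans #|[set nth x0 s k]|); last by rewrite cards1.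
  apply: subset_leq_card; apply/subsetP => x; rewrite !inE (take_nth x0)// mem_rcons inE.
  by case: (x \in take k s); rewrite ?orbF ?andbF.
rewrite /W; have [h1 _] := leq_card_setU (E' k :|: E' k.+1) (L k.+1 :\: L k).
have [h2 _] := leq_card_setU (E' k) (E' k.+1).
by have := E'w k; have := E'w k.+1; move: h1 h2 L1; lia.
Qed.

Let M_W k I J : M k I J :\: W k = splice (L k) I J :\: W k.
Proof. by apply: fill_setD; rewrite /W -setUA subsetUl. Qed.

Let MS_W k I J : M k.+1 I J :\: W k = splice (L k) I J :\: W k.
Proof.
rewrite /M fill_setD; last by rewrite /W -setUA setUCA subsetUl.
have LS : L k \subset L k.+1.
  apply/subsetP => x; rewrite !inE.
  by rewrite -(take_takel s (leqnSn k)) => /mem_take.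
apply/setP => x; rewrite /W !inE; have := subsetP LS x; rewrite !inE.
case: (x \in take k s); case: (x \in take k.+1 s) => //= h; rewrite ?orbT ?orbF //.
  by have := h isT.
Qed.

Lemma poincare f :
  \sum_(I in F) \sum_(J in F) weight I * weight J * (f I - f J) ^+ 2 <=
  (size s)%:R ^+ 2 * poincare_const * weight_total *
  \sum_(B in F) weight B * local_energy f B.
Proof.
set e := \sum_(B in F) weight B * local_energy f B.
have e0 : 0 <= e by apply: sumr_ge0 => B _; rewrite mulr_ge0 ?weight_ge0 ?local_energy_ge0.
pose K : R := 4 ^+ (2 * w).+2.
pose q k I J := \sum_(B in F | B :\: W k == splice (L k) I J :\: W k) local_energy f B.
have K0 : 0 <= K by rewrite exprn_ge0.
(* Cauchy-Schwarz along the path gives one factor [m]; the sum over [k] supplies the other at the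
   end. *)
apply: (@le_trans _ _ (\sum_(I in F) \sum_(J in F) weight I * weight J *
    (m%:R * \sum_(k < m) K * q k I J))).
  apply: ler_sum => I IF; apply: ler_sum => J JF.
  rewrite ler_wpM2l ?mulr_ge0 ?weight_ge0//.
  have := sqr_telescope_le (fun k => f (M k I J)) m; rewrite M0 Mm// => h.
  apply: (le_trans h); rewrite ler_wpM2l//; apply: ler_sum => k _.
  have := sqr_block_le f (W_sub k) (M_valid k IF JF) (M_valid k.+1 IF JF).
  rewrite M_W MS_W => /(_ erefl) hk; apply: (le_trans hk).
  rewrite -/(q k I J) ler_wpM2r//; first by apply: sumr_ge0 => B _; exact: local_energy_ge0.
  by rewrite ler_weXn2l ?ler1n// ltnS W_card.
have -> : \sum_(I in F) \sum_(J in F) weight I * weight J * (m%:R * \sum_(k < m) K * q k I J) =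
    m%:R * K * \sum_(k < m) \sum_(I in F) \sum_(J in F) weight I * weight J * q k I J.
  rewrite [in RHS]exchange_big /= mulr_sumr; apply: eq_bigr => I _.
  rewrite [in RHS]exchange_big /= mulr_sumr; apply: eq_bigr => J _.
  rewrite !mulr_sumr; apply: eq_bigr => k _; ring.
have hk (k : 'I_m) : \sum_(I in F) \sum_(J in F) weight I * weight J * q k I J <=
    block_const ^+ (2 * (2 * w).+2) * weight_total * e.
  (* With [B] fixed first, the inner sum over pairs routed through the block of [B] is the
     congestion, which the encoding bounds. *)
  have -> : \sum_(I in F) \sum_(J in F) weight I * weight J * q k I J =
    \sum_(B in F) (local_energy f B * \sum_(I in F)
      \sum_(J in F | splice (L k) I J :\: W k == B :\: W k) weight I * weight J).
    transitivity (\sum_(I in F) \sum_(B in F) local_energy f B *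
      \sum_(J in F | splice (L k) I J :\: W k == B :\: W k) weight I * weight J); last first.
      by rewrite exchange_big /=; apply: eq_bigr => B _; rewrite mulr_sumr.
    apply: eq_bigr => I _.
    under eq_bigr => J _ do rewrite /q mulr_sumr big_mkcondr /=.
    rewrite exchange_big /=; apply: eq_bigr => B _.
    rewrite mulr_sumr [RHS]big_mkcondr /=; apply: eq_bigr => J _.
    by rewrite eq_sym; case: ifP => // _; rewrite mulrC.
  rewrite /e mulr_sumr; apply: ler_sum => B _.
  rewrite [weight B * _]mulrC [leRHS]mulrCA ler_wpM2l ?local_energy_ge0//.
  apply: (le_trans (@sum_splice_le (L k) (W k) B _)).
    by move=> I J IF JF; exists (M k I J); [exact: M_valid|exact: M_W].
  rewrite ler_wpM2r ?weight_ge0// ler_wpM2r ?weight_total_ge0//.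
  by rewrite ler_weXn2l ?block_const_ge1// leq_mul2l /= (leq_trans (W_card k)).
apply: (@le_trans _ _ (m%:R * K * \sum_(k < m)
    (block_const ^+ (2 * (2 * w).+2) * weight_total * e))).
  by apply: ler_wpM2l; [exact: mulr_ge0|apply: ler_sum => k _; exact: hk].
have -> : poincare_const = K * block_const ^+ (2 * (2 * w).+2).
  by rewrite /poincare_const exprMn -exprM.
rewrite sumr_const card_ord -[_ *+ m]mulr_natl -/m; move: (block_const ^+ _) => bb.
by rewrite le_eqVlt; apply/orP; left; apply/eqP; ring.
Qed.

End Poincare.

(** * From the Poincare inequality to decay in chi-square *)

Section Chain.
Variables (R : realType) (X : finType) (D : {set X}) (F : {set {set X}}).
Variables (lambda : R).
Hypothesis lambda_gt0 : 0 < lambda.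
Hypothesis subD : forall S, S \in F -> S \subset D.
Implicit Types (S T U A : {set X}) (h : {set X} -> R).

Let wt := weight lambda (X := X).
Let Zf := weight_total F lambda.

Definition site_average x h T : R :=
  \sum_(U in F) glauber_update F lambda x T U * h U.

Definition chain_average h T : R :=
  \sum_(U in F) glauber_step D F lambda T U * h U.

Let lambda1_neq0 : lambda + 1 != 0.
Proof. by rewrite gt_eqF// addr_gt0. Qed.

Lemma weight_setU1 x S : x \notin S -> wt (x |: S) = lambda * wt S.
Proof. by move=> xS; rewrite /wt /weight cardsU1 xS exprS. Qed.

Lemma sum_indicator A h : A \in F -> \sum_(U in F) (U == A)%:R * h U = h A.
Proof.
move=> AF; rewrite (bigD1 A)//= eqxx mul1r big1 ?addr0// => U /andP[_ /negbTE->].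
by rewrite mul0r.
Qed.

Lemma toggle_neighbours x T : T \in F -> toggle x T \in F ->
  (x |: T \in F) && (T :\ x \in F).
Proof.
rewrite /toggle; case: ifP => xT TF tF; rewrite tF ?andbT /=.
  by rewrite (setUidPr _) ?sub1set.
by rewrite (setDidPl _)// disjoint_sym disjoints1 xT.
Qed.

Lemma site_averageE x h T : T \in F -> site_average x h T =
  if toggle x T \in F then lambda / (lambda + 1) * h (x |: T) + 1 / (lambda + 1) * h (T :\ x)
  else h T.
Proof.
move=> TF; rewrite /site_average /glauber_update; case: ifPn => tF; last exact: sum_indicator.
have /andP[uF dF] := toggle_neighbours TF tF.
rewrite -(sum_indicator h uF) -(sum_indicator h dF) !mulr_sumr -big_split.
by apply: eq_bigr => U _ /=; ring.
Qed.

(** On a pair [U], [x |: U] of valid sets the update replaces [h] by its mean, so the loss is a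
    two-point variance. Terms are bounded one by one, using that [wt T] is at most the weight of its
    pair. *)
Lemma site_average_dissipation x h :
  lambda / (lambda + 1) ^+ 2 / 2 *
    \sum_(T in F | toggle x T \in F) wt T * (h T - h (toggle x T)) ^+ 2 <=
  \sum_(T in F) wt T * h T ^+ 2 - \sum_(T in F) wt T * site_average x h T ^+ 2.
Proof.
pose phi T := wt T * (h T ^+ 2 - site_average x h T ^+ 2).
have -> : \sum_(T in F) wt T * h T ^+ 2 - \sum_(T in F) wt T * site_average x h T ^+ 2 =
    \sum_(T in F | toggle x T \in F) phi T.
  rewrite -sumrB [RHS]big_mkcondr /=; apply: eq_bigr => T TF.
  rewrite /phi site_averageE//; case: ifP => _; ring.
(* Each term is averaged with that of its toggle, so that both members of a pair appear together. *)
have e : \sum_(T in F | toggle x T \in F) phi T =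
    \sum_(T in F | toggle x T \in F) phi (toggle x T).
  rewrite (reindex_inj (inv_inj (toggleK x))) /=.
  by apply: eq_bigl => T; rewrite toggleK andbC.
have -> : \sum_(T in F | toggle x T \in F) phi T =
    2^-1 * \sum_(T in F | toggle x T \in F) (phi T + phi (toggle x T)).
  by rewrite big_split /= -e; field.
rewrite -mulrA mulrCA; rewrite ler_wpM2l ?invr_ge0// mulr_sumr.
apply: ler_sum => T /andP[TF tF].
have tT : toggle x (toggle x T) \in F by rewrite toggleK.
rewrite /phi !site_averageE// tT tF.
pose U := T :\ x; pose v := wt U; pose a := h (x |: U); pose b := h U.
have v0 : 0 <= v by exact: weight_ge0.
have xU : x \notin U by rewrite !inE eqxx.
have wU : wt (x |: U) = lambda * v by exact: weight_setU1.
have eU A : A = U \/ A = x |: U -> (A :\ x = U) /\ (x |: A = x |: U).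
  case=> ->; split; rewrite ?setU1K ?setUA ?setUid//.
  by rewrite (setDidPl _)// disjoint_sym disjoints1.
have cases : (T = U /\ toggle x T = x |: U) \/ (T = x |: U /\ toggle x T = U).
  rewrite /toggle; case: ifP => xT; [right|left].
    by rewrite /U setD1K.
  have -> : U = T by rewrite /U (setDidPl _)// disjoint_sym disjoints1 xT.
  by [].
have l1 : 0 < lambda + 1 by rewrite addr_gt0.
have dirichlet : lambda * v * (a ^+ 2 - (lambda / (lambda + 1) * a + 1 / (lambda + 1) * b) ^+ 2) +
   v * (b ^+ 2 - (lambda / (lambda + 1) * a + 1 / (lambda + 1) * b) ^+ 2) =
   lambda / (lambda + 1) ^+ 2 * ((lambda + 1) * v * (a - b) ^+ 2).
  by field.
have k0 : 0 <= lambda / (lambda + 1) ^+ 2.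
  by rewrite divr_ge0 ?exprn_ge0// ltW.
have sq : 0 <= v * (a - b) ^+ 2 by rewrite mulr_ge0 ?sqr_ge0.
have lsq : 0 <= lambda * (v * (a - b) ^+ 2) by rewrite mulr_ge0 ?(ltW lambda_gt0).
case: cases => -[eT et].
  have [-> ->] := eU T (or_introl eT); have [-> ->] := eU (toggle x T) (or_intror et).
  rewrite et eT wU -/v -/a -/b [leRHS]addrC dirichlet ler_wpM2l//.
  by rewrite -[(b - a)]opprB sqrrN; lra.
have [-> ->] := eU T (or_intror eT); have [-> ->] := eU (toggle x T) (or_introl et).
rewrite et eT wU -/v -/a -/b dirichlet ler_wpM2l//.
lra.
Qed.

(** Detailed balance at one site: the weights across a toggle have ratio [lambda], the two
    transition probabilities the inverse ratio. *)
Lemma glauber_update_sym x T U : T \in F -> U \in F ->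
  wt T * glauber_update F lambda x T U = wt U * glauber_update F lambda x U T.
Proof.
move=> TF UF; have [->//|neUT] := eqVneq U T.
have [UE|nt] := eqVneq U (toggle x T); last first.
  have nt' : T != toggle x U by apply: contraNneq nt => ->; rewrite toggleK.
  have no A B : B != A -> B != toggle x A -> glauber_update F lambda x A B = 0.
    move=> BA Bt; rewrite /glauber_update (negbTE BA).
    have [-> ->] : (B == x |: A) = false /\ (B == A :\ x) = false.
      move: Bt; rewrite /toggle; case: ifP => xA /negbTE Bt; split=> //.
        by rewrite (setUidPr _) ?sub1set// (negbTE BA).
      by rewrite (setDidPl _) ?(negbTE BA)// disjoint_sym disjoints1 xA.
    by rewrite !mulr0 addr0 if_same.
  by rewrite (no T U)// (no U T) ?mulr0// eq_sym.
rewrite {}UE {neUT} in UF *; rewrite /glauber_update toggleK TF UF.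
rewrite /toggle; case: ifP => xT.
  rewrite setD1K// eqxx setDDl setUid.
  have -> : (T :\ x == x |: T) = false.
    by apply/negbTE/eqP => e; have := setU11 x T; rewrite -e !inE eqxx.
  have -> : (T == T :\ x) = false.
    by apply/negbTE/eqP => e; move: xT; rewrite e !inE eqxx.
  have -> : wt T = lambda * wt (T :\ x) by rewrite -(@weight_setU1 x) ?setD1K// !inE eqxx.
  by rewrite ?eqxx /= ?mulr0n ?mulr1n; field.
rewrite setUA setUid setU1K ?xT// !eqxx weight_setU1 ?xT//.
have -> : (x |: T == T :\ x) = false.
  by apply/negbTE/eqP => e; have := setU11 x T; rewrite e !inE eqxx.
have -> : (T == x |: T) = false.
  by apply/negbTE/eqP => e; move: xT; rewrite e !inE eqxx.
by rewrite /= ?mulr0n ?mulr1n; field.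
Qed.

Hypothesis D_neq0 : D != set0.

Let m := #|D|.

Let m_gt0 : 0 < m%:R :> R.
Proof. by rewrite ltr0n card_gt0. Qed.

Lemma glauber_step_sym T U : T \in F -> U \in F ->
  wt T * glauber_step D F lambda T U = wt U * glauber_step D F lambda U T.
Proof.
move=> TF UF; rewrite /glauber_step (negbTE D_neq0) mulrCA [RHS]mulrCA.
congr (_ * _); rewrite !mulr_sumr; apply: eq_bigr => x _.
exact: glauber_update_sym.
Qed.

Lemma chain_averageE h T : chain_average h T = m%:R^-1 * \sum_(x in D) site_average x h T.
Proof.
rewrite /chain_average /glauber_step (negbTE D_neq0) /site_average exchange_big /=.
rewrite mulr_sumr; apply: eq_bigr => U _.
by rewrite -mulr_suml mulrA.
Qed.

(* Each [site_average x] is an orthogonal projection of L^2(weight), so the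
   average [P] of them satisfies |P h|^2 <= <h, P h>; no spectral theory is
   needed to pass from a Poincare inequality to decay of the variance. *)
Lemma chain_average_dissipation h :
  lambda / (lambda + 1) ^+ 2 / 2 / m%:R * \sum_(T in F) wt T * local_energy D F h T <=
  \sum_(T in F) wt T * h T ^+ 2 - \sum_(T in F) wt T * chain_average h T ^+ 2.
Proof.
set k := lambda / _ / 2; set n2 := \sum_(T in F) wt T * h T ^+ 2.
(* Convexity of the square under the uniform choice of [x]. *)
have jensen : \sum_(T in F) wt T * chain_average h T ^+ 2 <=
    m%:R^-1 * \sum_(x in D) \sum_(T in F) wt T * site_average x h T ^+ 2.
  rewrite exchange_big mulr_sumr /=; apply: ler_sum => T TF.
  rewrite -mulr_sumr [leRHS]mulrCA ler_wpM2l ?weight_ge0// chain_averageE exprMn.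
  rewrite expr2 -mulrA ler_wpM2l ?invr_ge0 ?(ltW m_gt0)// mulrC.
  by rewrite ler_pdivrMr// [leRHS]mulrC; exact: sqr_sum_le.
have sites : k * \sum_(T in F) wt T * local_energy D F h T <=
    m%:R * n2 - \sum_(x in D) \sum_(T in F) wt T * site_average x h T ^+ 2.
  have -> : m%:R * n2 = \sum_(x in D) n2 by rewrite sumr_const mulr_natl.
  rewrite -sumrB.
  have -> : \sum_(T in F) wt T * local_energy D F h T =
      \sum_(x in D) \sum_(T in F | toggle x T \in F) wt T * (h T - h (toggle x T)) ^+ 2.
    under eq_bigr do rewrite /local_energy mulr_sumr big_mkcondr.
    by rewrite exchange_big /=; apply: eq_bigr => x _; rewrite -big_mkcondr.
  by rewrite mulr_sumr; apply: ler_sum => x _; exact: site_average_dissipation.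
have h1 : k / m%:R * \sum_(T in F) wt T * local_energy D F h T <=
    n2 - m%:R^-1 * \sum_(x in D) \sum_(T in F) wt T * site_average x h T ^+ 2.
  rewrite mulrAC mulrC (_ : n2 = m%:R^-1 * (m%:R * n2)); last by rewrite mulKf ?gt_eqF.
  by rewrite -mulrBr ler_wpM2l// invr_ge0 ltW.
by apply: (le_trans h1); rewrite lerB.
Qed.

Variables (S0 : {set X}) (C : R).
Hypothesis S0F : S0 \in F.
Hypothesis C_gt0 : 0 < C.
Hypothesis poincareC : forall f,
  \sum_(I in F) \sum_(J in F) wt I * wt J * (f I - f J) ^+ 2 <=
  C * Zf * \sum_(B in F) wt B * local_energy D F f B.

(** Taken with respect to the unnormalised weight, so equilibrium is the constant [Zf^-1]. *)
Definition density n T : R := glauber_dist D F lambda n S0 T / wt T.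

(** By reversibility the density of the law evolves under the same averaging operator that acts on
    functions. *)
Lemma densityS n T : T \in F -> density n.+1 T = chain_average (density n) T.
Proof.
move=> TF; rewrite /density /= /chain_average mulr_suml; apply: eq_bigr => U UF.
have wT : wt T != 0 by rewrite gt_eqF// weight_gt0.
have wU : wt U != 0 by rewrite gt_eqF// weight_gt0.
apply: (mulIf wT); apply: (mulIf wU).
rewrite mulfVK// -!mulrA [glauber_step _ _ _ U T * _]mulrC (glauber_step_sym UF TF).
by field.
Qed.

Lemma sum_chain_average h : \sum_(T in F) wt T * chain_average h T = \sum_(T in F) wt T * h T.
Proof.
have one U : U \in F -> \sum_(T in F) glauber_step D F lambda U T = 1.
  move=> UF; have := chain_averageE (fun _ => 1) U.
  rewrite /chain_average; under eq_bigr do rewrite mulr1.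
  move=> ->; rewrite (eq_bigr (fun _ => 1)) ?sumr_const ?mulVf ?gt_eqF//.
  move=> x _; rewrite site_averageE//; case: ifP => // _; by field.
rewrite /chain_average; under eq_bigr do rewrite mulr_sumr.
rewrite exchange_big /=; apply: eq_bigr => U UF.
rewrite -[RHS]mulr1 -(one U UF) mulr_sumr; apply: eq_bigr => T TF.
by rewrite mulrA (glauber_step_sym TF UF) mulrAC.
Qed.

Lemma sum_density n : \sum_(T in F) wt T * density n T = 1.
Proof.
elim: n => [|n IH].
  rewrite (eq_bigr (fun T => (T == S0)%:R * 1)) ?sum_indicator// => T TF.
  by rewrite /density /= mulrC mulfVK ?mulr1// gt_eqF// weight_gt0.
by rewrite -IH -[RHS]sum_chain_average; apply: eq_bigr => T TF; rewrite densityS.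
Qed.

(** The chi-square divergence from the stationary law, which is also the stationary variance of the
    density normalised to mean 1. *)
Definition chi_square n : R := Zf * (\sum_(T in F) wt T * density n T ^+ 2) - 1.

Lemma chi_squareE n :
  \sum_(I in F) \sum_(J in F) wt I * wt J * (density n I - density n J) ^+ 2 =
  2 * chi_square n.
Proof. by rewrite sum_sqr_diff sum_density /chi_square expr1n mulr1 mulrBr mulr1. Qed.

Lemma chi_square_ge0 n : 0 <= chi_square n.
Proof.
have : 0 <= 2 * chi_square n; last by rewrite pmulr_rge0.
rewrite -chi_squareE; apply: sumr_ge0 => I _; apply: sumr_ge0 => J _.
by apply: mulr_ge0; [apply: mulr_ge0; exact: weight_ge0|exact: sqr_ge0].
Qed.

Definition gap : R := lambda / (lambda + 1) ^+ 2 / (m%:R * C).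

Lemma gap_gt0 : 0 < gap.
Proof. by rewrite /gap !divr_gt0 ?mulr_gt0 ?exprn_gt0 ?addr_gt0. Qed.

(** The contraction by [1 - gap] is restated with [1 + gap] on the left, using
    [(1 + gap) * (1 - gap) <= 1]: this factor is positive whatever the size of [gap], and Bernoulli
    bounds its powers from below. *)
Lemma chi_squareS n : (1 + gap) * chi_square n.+1 <= chi_square n.
Proof.
have h1 := chain_average_dissipation (density n).
have h2 := poincareC (density n); rewrite chi_squareE in h2.
have Z0 : 0 <= Zf by exact: weight_total_ge0.
set e := \sum_(T in F) wt T * local_energy D F _ T in h1 h2.
set q := lambda / (lambda + 1) ^+ 2 in h1.
have eS : chi_square n.+1 =
    Zf * (\sum_(T in F) wt T * chain_average (density n) T ^+ 2) - 1.
  by congr (_ * _ - _); apply: eq_bigr => T TF; rewrite densityS.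
have q0 : 0 < q by rewrite divr_gt0// exprn_gt0// addr_gt0.
have step : chi_square n.+1 <= (1 - gap) * chi_square n.
  have h3 : gap * chi_square n <= Zf * (q / 2 / m%:R * e).
    have -> : Zf * (q / 2 / m%:R * e) = (q / (m%:R * C)) * (C * Zf * e / 2).
      by field; rewrite !gt_eqF.
    rewrite ler_wpM2l ?(ltW gap_gt0)// ler_pdivlMr// mulrC; exact: h2.
  have := ler_wpM2l Z0 h1; rewrite eS /chi_square in h3 *.
  rewrite mulrBr; lra.
have g0 := gap_gt0; have c0 := chi_square_ge0 n.
have : (1 + gap) * chi_square n.+1 <= (1 + gap) * ((1 - gap) * chi_square n).
  by rewrite ler_wpM2l// addr_ge0// ltW.
move/le_trans; apply.
have : 0 <= gap ^+ 2 * chi_square n by rewrite mulr_ge0 ?sqr_ge0.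
lra.
Qed.

Lemma chi_square_decay n : (1 + gap) ^+ n * chi_square n <= chi_square 0.
Proof.
elim: n => [|n IH]; first by rewrite mul1r.
apply: le_trans IH; rewrite exprSr -mulrA ler_wpM2l ?chi_squareS//.
by rewrite exprn_ge0// addr_ge0// ltW// gap_gt0.
Qed.

(** All valid sets agree off [D], so the family lies in a single block. *)
Lemma weight_total_le : Zf <= block_const lambda ^+ m * wt S0.
Proof.
apply: le_trans (sum_block_le lambda_gt0 D S0).
apply: ler_sum_subpred => [A AF|A _]; last exact: weight_ge0.
have noD B : B \in F -> B :\: D = set0 by move=> BF; apply/eqP; rewrite setD_eq0 subD.
by rewrite !noD.
Qed.

Lemma chi_square0_le : chi_square 0 <= block_const lambda ^+ m.
Proof.
have w0 : 0 < wt S0 by exact: weight_gt0.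
have -> : chi_square 0 = Zf / wt S0 - 1.
  congr (_ * _ - _); rewrite (eq_bigr (fun T => (T == S0)%:R * (wt T)^-1)).
    by rewrite sum_indicator.
  move=> T TF; rewrite /density /=; case: eqP => _; last by rewrite !mul0r expr0n mulr0.
  by rewrite !mul1r expr2 mulrA mulfV ?mul1r// gt_eqF// weight_gt0.
rewrite lerBlDr; apply: (@le_trans _ _ (block_const lambda ^+ m)); last by rewrite lerDl.
by rewrite ler_pdivrMr// weight_total_le.
Qed.

Lemma tv_sqr_le n :
  (2 * tv_distance F (glauber_dist D F lambda n S0) (glauber_stationary F lambda)) ^+ 2 <=
  chi_square n.
Proof.
have w0 : 0 < wt S0 by exact: weight_gt0.
have Z0 : 0 < Zf.
  by apply: lt_le_trans w0 _; apply: ler_sum_term => // *; exact: weight_ge0.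
have -> : 2 * tv_distance F (glauber_dist D F lambda n S0) (glauber_stationary F lambda) =
    \sum_(T in F) wt T * `|density n T - Zf^-1|.
  rewrite /tv_distance mulrA (_ : 2 * (1 / 2) = 1 :> R); last by field.
  rewrite mul1r; apply: eq_bigr => T TF.
  have wT : 0 < wt T by exact: weight_gt0.
  rewrite -[X in _ = X * _](gtr0_norm wT) -normrM; congr `|_|.
  by rewrite mulrBr /density mulrC mulfVK// gt_eqF.
apply: le_trans (weighted_sqr_sum_le _ _ _) _; first by move=> T; exact: weight_ge0.
have -> : \sum_(T in F) wt T * `|density n T - Zf^-1| ^+ 2 =
    \sum_(T in F) wt T * density n T ^+ 2 - 2 * Zf^-1 * (\sum_(T in F) wt T * density n T)
    + Zf^-2 * Zf.
  rewrite !mulr_sumr -sumrB -big_split /=; apply: eq_bigr => T _.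
  by rewrite -normrX ger0_norm ?sqr_ge0// -/(wt T);
     move: (wt T) (density n T) Zf Z0 => v d z z0; field; rewrite gt_eqF.
rewrite sum_density /chi_square -/Zf (_ : \sum_(i in F) wt i = Zf)//.
set z := \sum_(_ in _) _ * _ ^+ 2.
rewrite le_eqVlt; apply/orP; left; apply/eqP.
by move: z Zf Z0 => y z z0; field; rewrite gt_eqF.
Qed.

(** By Bernoulli [a] steps halve the chi-square distance. The first [q * m] halvings absorb its
    initial value, and three more bring it to 1/8, strictly below the 1/4 that a total variation
    distance of 1/4 would force. *)
Lemma tv_lt_quarter a q : 1 <= a%:R * gap -> block_const lambda <= 2 ^+ q ->
  tv_distance F (glauber_dist D F lambda (a * (q * m + 3)) S0)
    (glauber_stationary F lambda) < 1 / 4.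
Proof.
move=> ha hq; set n := (a * _)%N; have g0 := gap_gt0.
have bernoulli k : 1 + k%:R * gap <= (1 + gap) ^+ k.
  elim: k => [|k IH]; first by rewrite mul0r addr0.
  rewrite exprSr; have : 0 <= k%:R * gap ^+ 2 by rewrite mulr_ge0 ?sqr_ge0.
  have : (1 + k%:R * gap) * (1 + gap) <= (1 + gap) ^+ k * (1 + gap).
    by rewrite ler_wpM2r// addr_ge0// ltW.
  rewrite -natr1; lra.
have h2 : 2 <= (1 + gap) ^+ a by apply: le_trans (bernoulli a); lra.
have hn : 2 ^+ (q * m + 3) <= (1 + gap) ^+ n.
  rewrite /n exprM lerXn2r ?nnegrE//; exact: le_trans h2.
have hbc : block_const lambda ^+ m <= 2 ^+ (q * m).
  rewrite exprM lerXn2r ?nnegrE ?exprn_ge0//.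
  by apply: le_trans ler01 _; exact: block_const_ge1.
have c0 := chi_square_ge0 n.
have h8 : 8 * chi_square n <= 1.
  have p0 : 0 < 2 ^+ (q * m) :> R by exact: exprn_gt0.
  rewrite -(ler_pM2l p0) mulr1; apply: le_trans hbc; apply: le_trans chi_square0_le.
  apply: le_trans (chi_square_decay n).
  rewrite mulrA ler_wpM2r//; apply: le_trans hn; rewrite exprD le_eqVlt.
  by apply/orP; left; apply/eqP; ring.
have := tv_sqr_le n; set tv := tv_distance _ _ _ => htv.
rewrite ltNge; apply/negP => htv4.
have : (1 / 2) ^+ 2 <= (2 * tv) ^+ 2 by rewrite lerXn2r ?nnegrE; lra.
lra.
Qed.

End Chain.

(** * Explicit mixing times *)

Section MixingTime.
Variable R : realType.

Lemma le_pow2 (x : R) : exists N : nat, x <= 2 ^+ N.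
Proof.
exists (Num.bound `|x|); apply: le_trans (ler_norm x) _.
have /ltW/le_trans := archi_boundP (normr_ge0 x); apply.
by rewrite -natrX ler_nat ltnW// ltn_expl.
Qed.

(** [N] depends on [lambda] alone. The cube of [#|D|] is two path factors and one from the random
    choice of an element; the power of two covers the Poincare constant ([2 * w + 2] factors) and
    [d^-1] (one factor). *)
Lemma mixed_at_monotone_family (lambda : R) : 0 < lambda -> exists N : nat,
  forall (X : finType) (D : {set X}) (F : {set {set X}}) (c : bool)
    (s : seq X) (E : nat -> {set X}) (w : nat),
  (forall S, S \in F -> S \subset D) ->
  (forall S x, S \in F -> x \in D -> put c x S \in F) ->
  uniq s -> s =i D ->
  (forall k, E k \subset D) -> (forall k, (#|E k| <= w)%N) ->
  (forall k I J, I \in F -> J \in F ->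
     fill c (splice [set x in take k s] I J) (E k) \in F) ->
  mixed_at D F lambda (1 / 4)
    (#|D| ^ 3 * 2 ^ (N * (2 * w + 3)) * (N * #|D| + 3)).
Proof.
move=> l0; set d := lambda / (lambda + 1) ^+ 2.
have d0 : 0 < d by rewrite divr_gt0// exprn_gt0// addr_gt0.
have [N1 hN1] := le_pow2 (4 * block_const lambda ^+ 2).
have [N2 hN2] := le_pow2 d^-1.
exists (N1 + N2)%N; set N := (N1 + N2)%N => X D F c s E w subD put_closed us ms subE cE vE.
have le1 := block_const_ge1 l0.
have p1N : 4 * block_const lambda ^+ 2 <= 2 ^+ N.
  by apply: le_trans hN1 _; rewrite ler_weXn2l ?ler1n// leq_addr.
have hbN : block_const lambda <= 2 ^+ N by apply: le_trans p1N; nra.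
have hdN : d^-1 <= 2 ^+ N.
  by apply: le_trans hN2 _; rewrite ler_weXn2l ?ler1n// leq_addl.
(* Without ground elements the claimed time is 0, and the empty set is the only possible state. *)
have [D0|D0] := eqVneq D set0.
  have F0 S : S \in F -> S = set0 by move/subD; rewrite D0 subset0 => /eqP.
  rewrite D0 cards0 exp0n// !mul0n => S SF; rewrite /tv_distance big1 ?mulr0 ?divr_gt0// => T TF.
  rewrite /= (F0 S SF) (F0 T TF) eqxx /glauber_stationary.
  have -> : \sum_(U in F) lambda ^+ #|U| = 1.
    rewrite (bigD1 T)//= (F0 T TF) cards0 big1 ?addr0// => U /andP[/F0->].
    by rewrite eqxx.
  by rewrite cards0 divr1 subrr normr0.
have m0 : 0 < #|D|%:R :> R by rewrite ltr0n card_gt0.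
have sm : size s = #|D| by rewrite -(card_uniqP us); apply: eq_card.
have pc0 : 0 < poincare_const lambda w.
  by rewrite exprn_gt0// mulr_gt0// exprn_gt0// (lt_le_trans ltr01).
have C0 : 0 < (size s)%:R ^+ 2 * poincare_const lambda w.
  by rewrite sm; apply: mulr_gt0 => //; exact: exprn_gt0.
move=> S SF.
apply: (tv_lt_quarter l0 subD D0 SF C0 _ _ hbN).
  exact: (poincare l0 subD put_closed ms subE cE vE).
rewrite /gap -/d sm mulrA ler_pdivlMr ?mul1r; last first.
  by do 2?[apply: mulr_gt0 => //]; exact: exprn_gt0.
have -> : #|D|%:R * (#|D|%:R ^+ 2 * poincare_const lambda w) =
  #|D|%:R ^+ 3 * (poincare_const lambda w * d^-1) * d.
  by field; rewrite gt_eqF.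
rewrite ler_wpM2r ?(ltW d0)// natrM !natrX ler_wpM2l ?exprn_ge0//.
rewrite addnS mulnS addnC exprD mulrC [leRHS]mulrC.
apply: ler_pM; rewrite ?(ltW pc0) ?invr_ge0 ?(ltW d0)//.
rewrite /poincare_const addn2 exprM lerXn2r// nnegrE ?exprn_ge0// mulr_ge0// exprn_ge0//.
exact: le_trans le1.
Qed.

Lemma is_mixing_time_exists (X : finType) (D : {set X}) (F : {set {set X}})
    (lambda eps : R) n :
  mixed_at D F lambda eps n ->
  exists2 tau, is_mixing_time D F lambda eps tau & (tau <= n)%N.
Proof.
move=> mixn; have ex : exists k, `[< mixed_at D F lambda eps k >] by exists n; apply/asboolP.
case: (ex_minnP ex) => tau /asboolP mixtau min; exists tau.
  by split=> // r mixr; apply: min; apply/asboolP.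
by apply: min; apply/asboolP.
Qed.

Lemma leq_expl m n e : (m <= n)%N -> (m ^ e <= n ^ e)%N.
Proof. by case: e => // e mn; rewrite leq_exp2r. Qed.

(** The first term pays for the power of two; [N + 11] covers 6 from [m ^ 3] and [N + 3] from the
    last factor. *)
Definition mixing_exponent (N p : nat) : nat := (2 * (N * (2 * p + 3)) + N + 11)%N.

Lemma mixing_bound N p n t m w : (1 < n)%N -> (0 < t)%N -> (m <= n ^ 2)%N ->
  (w <= p * ((trunc_log 2 n).+1 * t))%N ->
  (m ^ 3 * 2 ^ (N * (2 * w + 3)) * (N * m + 3) <= n ^ (mixing_exponent N p * t))%N.
Proof.
move=> n1 t0 mn hw; set k := (trunc_log 2 n).+1 in hw *.
have n0 : (0 < n)%N by exact: ltnW.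
(* Here [2 ^ O(t log n)] becomes [n ^ O(t)]; the extra factor 2 from [k] is absorbed since
   [n >= 2]. *)
have h2k : (2 ^ k <= n ^ 2)%N.
  by rewrite (expnS 2 (trunc_log 2 n)) -mulnn leq_mul// trunc_logP.
have h1 : (2 ^ (N * (2 * w + 3)) <= n ^ (2 * (N * (2 * p + 3)) * t))%N.
  apply: (@leq_trans (2 ^ (k * (N * (2 * p + 3) * t)))).
    have kt : (0 < k * t)%N by rewrite muln_gt0.
    have -> : (k * (N * (2 * p + 3) * t) = N * (2 * (p * (k * t)) + 3 * (k * t)))%N by ring.
    by rewrite leq_pexp2l// leq_mul2l leq_add ?orbT// ?leq_mul2l ?leq_pmulr.
  rewrite (expnM 2).
  have -> : (2 * (N * (2 * p + 3)) * t = 2 * (N * (2 * p + 3) * t))%N by rewrite !mulnA.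
  by rewrite (expnM n); exact: leq_expl.
have h2 : (m ^ 3 <= n ^ 6)%N by rewrite (expnM n 2 3) leq_exp2r.
have h3 : (N * m + 3 <= n ^ (N + 3))%N.
  have hN : (N <= n ^ N)%N.
    by apply: leq_trans (ltnW (ltn_expl N (ltnSn 1))) _; exact: leq_expl.
  have n4 : (4 <= n ^ N * n ^ 2)%N.
    by apply: (@leq_mul 1 4); [rewrite expn_gt0 n0|exact: (@leq_expl 2 n 2)].
  have := leq_mul hN mn; rewrite addn3 (expnS n) -addn2 expnD.
  have : (2 * (n ^ N * n ^ 2) <= n * (n ^ N * n ^ 2))%N by rewrite leq_mul2r n1 orbT.
  lia.
apply: (leq_trans (leq_mul (leq_mul h2 h1) h3)).
rewrite -!expnD leq_pexp2l// /mixing_exponent.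
by move: (N * (2 * p + 3))%N => z; nia.
Qed.

Lemma le_natr_powR n M e tau : (0 < n)%N -> (tau <= n ^ (M * e))%N ->
  tau%:R <= n%:R `^ (M%:R * e%:R) :> R.
Proof.
by move=> n0 le_tau; rewrite -natrM powR_mulrn// -natrX ler_nat.
Qed.

End MixingTime.

(** * Patches for dominating sets *)

Section DominatingSets.
Variables (G : sgraph) (s : seq G).
Hypothesis mem_s : s =i [set: G].

Lemma mem_drop_cut k (x : G) : (x \in drop k s) || (x \in take k s).
Proof. by rewrite orbC -mem_cat cat_take_drop mem_s inE. Qed.

Lemma mem_dominating (S : {set G}) (v : G) :
  S \in dominating_sets G -> (v \in S) || [exists u in S, adj v u].
Proof. by rewrite inE => /forallP/(_ v). Qed.

Lemma dominating_setU1 (S : {set G}) x :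
  S \in dominating_sets G -> x |: S \in dominating_sets G.
Proof.
move=> domS; rewrite inE; apply/forallP => v.
case/orP: (mem_dominating v domS) => [vS|/existsP[u /andP[uS avu]]].
  by rewrite setU1r.
by apply/orP; right; apply/existsP; exists u; rewrite setU1r.
Qed.

(** A prefix vertex outside the front has all its neighbours in the prefix, where the splice is [J].
    A suffix vertex is dominated by [I]; if its dominator lies in the prefix, that dominator is in
    the front and has been added. *)
Lemma dominating_splice k (I J : {set G}) :
  I \in dominating_sets G -> J \in dominating_sets G ->
  fill true (splice [set x in take k s] I J) (cut_front s k) \in dominating_sets G.
Proof.
move=> domI domJ; rewrite inE; apply/forallP => v; rewrite -implyNb.
apply/implyP; rewrite !inE => /norP[vZ vE].
have [vk|vk] := boolP (v \in take k s).
  rewrite vk /= andbT orbF in vZ vE.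
  case/orP: (mem_dominating v domJ) => [vJ|/existsP[u /andP[uJ avu]]]; first by rewrite vJ in vZ.
  have [uk|uk] := boolP (u \in take k s).
    by apply/existsP; exists u; rewrite !inE uJ uk.
  case/existsP: vE; exists u; rewrite avu andbT.
  by have := mem_drop_cut k u; rewrite (negbTE uk) orbF.
rewrite (negbTE vk) /= andbF in vZ.
case/orP: (mem_dominating v domI) => [vI|/existsP[u /andP[uI avu]]]; first by rewrite vI in vZ.
apply/existsP; exists u; rewrite !inE uI avu andbT /=.
case: (boolP (u \in take k s)) => uk; last by rewrite orbT.
apply/orP; right => /=; apply/existsP; exists v; rewrite adj_sym avu andbT.
by have := mem_drop_cut k v; rewrite (negbTE vk) orbF.
Qed.

End DominatingSets.

(** * Edge orders induced by a vertex order *)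

Section EdgeOrder.
Variable G : sgraph.
Implicit Types (v : G) (e : {set G}).

Lemma edge_other_end v e : e \in edge_set G -> v \in e ->
  exists2 u, adj v u & e = [set v; u].
Proof.
rewrite inE => /existsP[x /existsP[y /andP[axy /eqP->]]].
rewrite !inE => /orP[/eqP->|/eqP->]; first by exists y.
by exists x; [rewrite adj_sym|rewrite setUC].
Qed.

Lemma card_edge_set : (#|edge_set G| <= #|G| ^ 2)%N.
Proof.
rewrite -mulnn -card_prod.
apply: leq_trans (leq_imset_card (fun p : G * G => [set p.1; p.2]) predT).
apply: subset_leq_card; apply/subsetP => e; rewrite inE.
case/existsP=> x /existsP[y /andP[_ /eqP->]].
by apply/imsetP; exists (x, y).
Qed.

Lemma card_incident_le v : (#|incident (edge_set G) v| <= max_degree G)%N.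
Proof.
apply: leq_trans (leq_bigmax v).
apply: leq_trans (leq_imset_card (fun u => [set v; u]) _).
apply: subset_leq_card; apply/subsetP => e; rewrite inE => /andP[eE ve].
have [u avu ->] := edge_other_end eE ve.
by apply/imsetP; exists u; rewrite ?inE.
Qed.

Variables (s : seq G) (w : nat).
Hypothesis mem_s : s =i [set: G].
Hypothesis card_s : forall k, (#|cut_front s k| <= w)%N.

Definition last_end e : nat := \max_(x in e) index x s.

Definition edge_order : seq {set G} :=
  sort (relpre last_end leq) (enum (edge_set G)).

Lemma edge_order_uniq : uniq edge_order.
Proof. by rewrite sort_uniq enum_uniq. Qed.

Lemma mem_edge_order : edge_order =i edge_set G.
Proof. by move=> e; rewrite mem_sort mem_enum. Qed.

Definition mixed_vertices j : {set G} :=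
  [set v | has (fun e => v \in e) (take j edge_order)
        && has (fun e => v \in e) (drop j edge_order)].

(** Let [r] be the position of the later end of the first edge after the cut. A mixed vertex has an
    edge before the cut, so its position is at most [r]. If it is smaller, its edge after the cut
    leads to position [r] or beyond, which puts it in the front at [r]; the vertex at position [r]
    is the extra one. *)
Lemma card_mixed_vertices j : (#|mixed_vertices j| <= w.+1)%N.
Proof.
have leT : transitive (relpre last_end leq) by move=> y x z; exact: leq_trans.
have srt : sorted (relpre last_end leq) edge_order.
  by apply: sort_sorted => x y; exact: leq_total.
move: srt; rewrite (sorted_pairwise leT) -{1}(cat_take_drop j edge_order) pairwise_cat.
have mem_drop_s e : e \in drop j edge_order -> e \in edge_set G.
  by move=> /mem_drop; rewrite mem_edge_order.
rewrite /mixed_vertices; case: (drop j edge_order) mem_drop_s => [|e0 es] mem_es.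
  by move=> _; rewrite (_ : [set _ | _] = set0) ?cards0//; apply/setP => v; rewrite !inE andbF.
case/and3P=> /allrelP le_cut _ /= /andP[/allP le_e0 _].
have [v0 _] : exists v0 : G, true.
  by have := mem_es e0 (mem_head _ _); rewrite inE => /existsP[v0 _]; exists v0.
pose r := last_end e0.
apply: (@leq_trans #|nth v0 s r |: cut_front s r|); last first.
  by rewrite cardsU1 -add1n leq_add// leq_b1.
apply: subset_leq_card; apply/subsetP => v; rewrite !inE => /andP[/hasP[e ee ve]].
have vs x : x \in s by rewrite mem_s inE.
have index_v : (index v s <= r)%N.
  apply: (@leq_trans (last_end e)); first by rewrite /last_end (bigD1 v)//= leq_maxl.
  by apply: le_cut => //; exact: mem_head.
have [vr|vr] := eqVneq (index v s) r.
  by move=> _; rewrite -vr nth_index ?eqxx.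
move=> mixed; have /hasP[f fes vf] : has (fun e => v \in e) (e0 :: es) by [].
have rf : (r <= last_end f)%N.
  by move: fes; rewrite inE => /orP[/eqP->//|/le_e0].
have [u avu ef] := edge_other_end (mem_es f fes) vf.
have vr' : (index v s < r)%N by rewrite ltn_neqAle vr.
have ur : (r <= index u s)%N.
  move: rf; rewrite /last_end ef; apply: contraLR; rewrite -!ltnNge => ur.
  have r0 : (0 < r)%N by exact: leq_trans vr'.
  rewrite -(prednK r0) ltnS; apply/bigmax_leqP => x.
  by rewrite -ltnS prednK// !inE => /orP[]/eqP->.
apply/orP; right; rewrite in_take// vr' /=; apply/existsP; exists u; rewrite avu andbT.
by have := mem_drop_cut mem_s r u; rewrite (in_take _ (vs u)) ltnNge ur orbF.
Qed.

Variables (local : G -> {set {set G}}) (p : nat).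
Hypothesis local_sub : forall v, local v \subset incident (edge_set G) v.
Hypothesis card_local : forall v, (#|local v| <= p)%N.

(** The patch: [local] provides [b] edges at a vertex for covers, all incident edges for
    matchings. *)
Definition mixed_edges j : {set {set G}} := \bigcup_(v in mixed_vertices j) local v.

Lemma mixed_edges_sub j : mixed_edges j \subset edge_set G.
Proof.
apply/bigcupsP => v _; apply: subset_trans (local_sub v) _.
by apply/subsetP => e; rewrite inE => /andP[].
Qed.

Lemma card_mixed_edges j : (#|mixed_edges j| <= p * w.+1)%N.
Proof.
apply: (@leq_trans (\sum_(v in mixed_vertices j) p)); last first.
  by rewrite sum_nat_const mulnC leq_mul2l card_mixed_vertices orbT.
apply: (@leq_trans (\sum_(v in mixed_vertices j) #|local v|)); last exact: leq_sum.
rewrite /mixed_edges; elim/big_rec2: _ => [|v k A _ le_A]; first by rewrite cards0.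
by have [le_U _] := leq_card_setU (local v) A; apply: leq_trans le_U _; rewrite leq_add2l.
Qed.

Lemma local_mixed_sub j v : v \in mixed_vertices j -> local v \subset mixed_edges j.
Proof. by move=> vj; exact: bigcup_sup. Qed.

(** All edges at an unmixed vertex lie on one side of the cut, so the splice copies [I] or [J]
    there. *)
Lemma unmixed_incident j v (I J : {set {set G}}) :
  I \subset edge_set G -> J \subset edge_set G -> v \notin mixed_vertices j ->
  incident (splice [set e in take j edge_order] I J) v = incident I v \/
  incident (splice [set e in take j edge_order] I J) v = incident J v.
Proof.
move=> IE JE; rewrite inE negb_and => /orP[] /hasPn unmixed; [left|right];
  apply/setP => e; rewrite !inE; have [ve|] := boolP (v \in e); rewrite ?andbF// !andbT.
  have et : (e \in take j edge_order) = false by apply/negP => /unmixed; rewrite ve.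
  by rewrite et andbF.
have [et|et] := boolP (e \in take j edge_order); first by rewrite andbT orbF.
have eE : e \notin edge_set G.
  rewrite -mem_edge_order -(cat_take_drop j edge_order) mem_cat (negbTE et) /=.
  by apply/negP => /unmixed; rewrite ve.
rewrite andbF /=; apply/idP/idP => [/(subsetP IE)|/(subsetP JE)]; by rewrite (negbTE eE).
Qed.

Lemma splice_edges_sub (L I J : {set {set G}}) :
  I \subset edge_set G -> J \subset edge_set G -> splice L I J \subset edge_set G.
Proof.
move=> IE JE; rewrite subUset (subset_trans (subsetIl _ _) JE).
by rewrite (subset_trans (subsetDl _ _) IE).
Qed.

End EdgeOrder.

(** * Patches for edge covers and matchings *)

Section EdgeFamilies.
Variables (b : nat) (G : sgraph).
Implicit Types (v : G) (S I J : {set {set G}}).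

Lemma edge_coverP S : reflect (S \subset edge_set G /\ forall v, (b <= #|incident S v|)%N)
  (S \in b_edge_covers b G).
Proof. by rewrite inE; apply: (iffP andP) => -[? /forallP]. Qed.

Lemma matchingP S : reflect (S \subset edge_set G /\ forall v, (#|incident S v| <= b)%N)
  (S \in b_matchings b G).
Proof. by rewrite inE; apply: (iffP andP) => -[? /forallP]. Qed.

Lemma incidentS S I v : S \subset I -> incident S v \subset incident I v.
Proof.
by move=> /subsetP SI; apply/subsetP => e; rewrite !inE => /andP[/SI-> ->].
Qed.

Lemma edge_cover_setU1 S e :
  S \in b_edge_covers b G -> e \in edge_set G -> e |: S \in b_edge_covers b G.
Proof.
move=> /edge_coverP[SE bS] eE; apply/edge_coverP; split.
  by rewrite subUset sub1set eE.
move=> v; apply: leq_trans (bS v) _; apply: subset_leq_card.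
by apply: incidentS; exact: subsetUr.
Qed.

Lemma matching_setD1 S e : S \in b_matchings b G -> S :\ e \in b_matchings b G.
Proof.
move=> /matchingP[SE bS]; apply/matchingP; split.
  by apply: subset_trans SE; exact: subsetDl.
move=> v; apply: leq_trans (bS v); apply: subset_leq_card.
by apply: incidentS; exact: subsetDl.
Qed.

(** Picked from a fixed enumeration, so that the patch cannot depend on the sets being spliced. *)
Definition some_incident v : {set {set G}} :=
  [set e in take b (enum (incident (edge_set G) v))].

Lemma some_incident_sub v : some_incident v \subset incident (edge_set G) v.
Proof. by apply/subsetP => e; rewrite inE => /mem_take; rewrite mem_enum. Qed.

Lemma card_some_incident v : #|some_incident v| = minn b #|incident (edge_set G) v|.
Proof.
by rewrite cardsE (card_uniqP _) ?take_uniq ?enum_uniq// size_take_min -cardE.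
Qed.

Variable s : seq G.

Lemma edge_cover_splice j I J :
  I \in b_edge_covers b G -> J \in b_edge_covers b G ->
  fill true (splice [set e in take j (edge_order s)] I J)
    (mixed_edges s some_incident j) \in b_edge_covers b G.
Proof.
move=> /edge_coverP[IE bI] /edge_coverP[JE bJ]; apply/edge_coverP; split.
  by rewrite subUset splice_edges_sub// mixed_edges_sub//; exact: some_incident_sub.
move=> v; have [vj|vj] := boolP (v \in mixed_vertices s j).
  (* The cover [I] itself shows that [v] has at least [b] incident edges, so the fixed choice really
     has [b]. *)
  apply: (@leq_trans #|some_incident v|).
    rewrite card_some_incident leq_min leqnn; apply: leq_trans (bI v) _.
    exact/subset_leq_card/incidentS.
  apply: subset_leq_card; apply/subsetP => e ev; rewrite !inE.
  have := subsetP (some_incident_sub v) e ev; rewrite inE => /andP[_ ->].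
  by rewrite (subsetP (local_mixed_sub _ vj) e ev) orbT.
apply: (@leq_trans #|incident (splice [set e in take j (edge_order s)] I J) v|).
  by case: (unmixed_incident IE JE vj) => ->.
by apply: subset_leq_card; apply: incidentS; exact: subsetUl.
Qed.

(** Mixed vertices lose all their edges; deletions elsewhere only help, and at unmixed vertices the
    splice had a degree from [I] or [J]. *)
Lemma matching_splice j I J :
  I \in b_matchings b G -> J \in b_matchings b G ->
  fill false (splice [set e in take j (edge_order s)] I J)
    (mixed_edges s (incident (edge_set G)) j) \in b_matchings b G.
Proof.
move=> /matchingP[IE bI] /matchingP[JE bJ].
have ZE := splice_edges_sub [set e in take j (edge_order s)] IE JE.
apply/matchingP; split; first by apply: subset_trans ZE; exact: subsetDl.
move=> v; have [vj|vj] := boolP (v \in mixed_vertices s j).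
  rewrite (_ : incident _ v = set0) ?cards0//; apply/setP => e; rewrite in_set0.
  apply/negP; rewrite inE => /andP[/setDP[eZ /negP eM] ve]; apply: eM.
  apply: (subsetP (local_mixed_sub _ vj)).
  by rewrite inE (subsetP ZE e eZ).
apply: (@leq_trans #|incident (splice [set e in take j (edge_order s)] I J) v|).
  by apply: subset_leq_card; apply: incidentS; exact: subsetDl.
by case: (unmixed_incident IE JE vj) => ->.
Qed.

End EdgeFamilies.

(** * The three mixing time bounds *)

Theorem theorem3 (R : realType) :
  [/\ forall (b : nat) (lambda : R), (1 <= b)%N -> 0 < lambda ->
        exists2 C : R, 0 < C &
        forall (t : nat) (G : sgraph),
          (1 <= t)%N -> (2 <= #|G|)%N -> (treewidth G <= t)%N ->
          exists2 tau : nat,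
            is_mixing_time (edge_set G) (b_edge_covers b G) lambda (1 / 4) tau &
            tau%:R <= #|G|%:R `^ (C * t%:R ^+ 2),
      forall lambda : R, 0 < lambda ->
        exists2 C : R, 0 < C &
        forall (t : nat) (G : sgraph),
          (1 <= t)%N -> (2 <= #|G|)%N -> (treewidth G <= t)%N ->
          exists2 tau : nat,
            is_mixing_time [set: G] (dominating_sets G) lambda (1 / 4) tau &
            tau%:R <= #|G|%:R `^ (C * t%:R) &
      forall (b Delta : nat) (lambda : R),
        (1 <= b)%N -> (1 <= Delta)%N -> 0 < lambda ->
        exists2 C : R, 0 < C &
        forall (t : nat) (G : sgraph),
          (1 <= t)%N -> (2 <= #|G|)%N -> (max_degree G <= Delta)%N ->
          (treewidth G <= t)%N ->
          exists2 tau : nat,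
            is_mixing_time (edge_set G) (b_matchings b G) lambda (1 / 4) tau &
            tau%:R <= #|G|%:R `^ (C * t%:R)].
Proof.
(* The factor 3 absorbs the extra vertex of each bag and the extra mixed vertex. *)
have width_bound p L t : (0 < t)%N -> (p * (L.+1 * t.+1).+1 <= 3 * p * (L.+1 * t))%N.
  move=> t0; rewrite -mulnA mulnCA leq_mul2l; apply/orP; right.
  have : (0 < L.+1 * t)%N by rewrite muln_gt0.
  by have : (L.+1 <= L.+1 * t)%N; [rewrite leq_pmulr|rewrite mulnS; lia].
split.
- move=> b lambda _ l0; have [N mixN] := mixed_at_monotone_family l0.
  exists (mixing_exponent N (3 * b))%:R; first by rewrite ltr0n /mixing_exponent addnS.
  move=> t G t0 n2 twG; have [s [us ms ws]] := treewidth_order twG.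
  have subE S : S \in b_edge_covers b G -> S \subset edge_set G by case/edge_coverP.
  have card_b (v : G) : (#|some_incident b v| <= b)%N.
    by rewrite card_some_incident geq_minl.
  have /is_mixing_time_exists[] := mixN _ _ _ true _ _ _ subE
    (fun S e SF eE => edge_cover_setU1 SF eE) (edge_order_uniq s) (mem_edge_order s)
    (mixed_edges_sub s (@some_incident_sub b G)) (card_mixed_edges ms ws card_b)
    (fun j I J => @edge_cover_splice b G s j I J).
  move=> tau mix le_tau; exists tau => //; rewrite -natrX.
  apply: le_natr_powR; first exact: ltnW.
  apply: leq_trans le_tau _.
  apply: leq_trans (mixing_bound N n2 t0 (card_edge_set G) (width_bound _ _ _ t0)) _.
  (* The exponent obtained is linear in [t]; [t <= t ^ 2] puts it in the stated form. *)
  by rewrite leq_pexp2l ?(ltnW n2)// leq_mul2l -mulnn leq_pmulr// orbT.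
- move=> lambda l0; have [N mixN] := mixed_at_monotone_family l0.
  exists (mixing_exponent N (3 * 1))%:R; first by rewrite ltr0n /mixing_exponent addnS.
  move=> t G t0 n2 twG; have [s [us ms ws]] := treewidth_order twG.
  have := mixN _ [set: G] (dominating_sets G) true s (cut_front s) _ (fun S _ => subsetT S)
    (fun S x SF _ => dominating_setU1 x SF) us ms (fun k => subsetT _) ws
    (dominating_splice ms).
  case/is_mixing_time_exists => tau mix le_tau; exists tau => //.
  apply: le_natr_powR; first exact: ltnW.
  apply: leq_trans le_tau _; apply: mixing_bound => //.
    by rewrite cardsT -mulnn leq_pmulr// ltnW.
  by apply: leq_trans (width_bound 1%N _ _ t0); rewrite mul1n.
move=> b Delta lambda _ _ l0; have [N mixN] := mixed_at_monotone_family l0.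
exists (mixing_exponent N (3 * Delta))%:R; first by rewrite ltr0n /mixing_exponent addnS.
move=> t G t0 n2 degG twG; have [s [us ms ws]] := treewidth_order twG.
have subE S : S \in b_matchings b G -> S \subset edge_set G by case/matchingP.
have card_Delta (v : G) : (#|incident (edge_set G) v| <= Delta)%N.
  exact: leq_trans (card_incident_le v) degG.
have /is_mixing_time_exists[] := mixN _ _ _ false _ _ _ subE
  (fun S e SF _ => matching_setD1 e SF) (edge_order_uniq s) (mem_edge_order s)
  (mixed_edges_sub s (fun v => subxx (incident (edge_set G) v)))
  (card_mixed_edges ms ws card_Delta) (fun j I J => @matching_splice b G s j I J).
move=> tau mix le_tau; exists tau => //.
apply: le_natr_powR; first exact: ltnW.
apply: leq_trans le_tau _.
exact: (mixing_bound N n2 t0 (card_edge_set G) (width_bound _ _ _ t0)).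
Qed.
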